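(* Let $c\ge2$ be an integer. For every integer $m\ge 0$, $$\zeta(-m)=\left(1-c^{m+1}\right)^{-1}\zeta_{(c)}(-m)=\frac{1}{1-c^{m+1}}\sum_{j=0}^{m}\frac{(-1)^j}{c^{j+1}}\left(\sum_{i=0}^{c-2}(c+i)\,\Delta_c^j(i+1)^{m}-(c-1)^2\,\Delta_c^j c^{m}\right).$$
   Context: $\zeta(s)$ is the (meromorphically continued) Riemann zeta function and $\zeta_{(c)}(s)=(1-c^{1-s})\zeta(s)$. For integers $c\ge 2$ and $n\ge1$, set $a_{c,n}=1-c$ if $n\equiv 0\pmod c$ and $a_{c,n}=1$ otherwise. For a sequence $(b_n)_{n\ge1}$ of complex numbers, $\Delta_c^0 b_n=b_n$ and $\Delta_c^k b_n=\sum_{i=1}^{c}a_{c,i}\,\Delta_c^{k-1}b_{n+i}$ for $k\ge1$. The symbol $\Delta_c^j n^{m}$ means $\Delta_c^j b_n$ for the sequence $b_n=n^m$; $\Delta_c^j(i+1)^{m}$ and $\Delta_c^j c^{m}$ are its values at $n=i+1$ and $n=c$. *)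

(* Defs.v *)
(* Stdlib reals with Coquelicot's complex numbers. *)
From Stdlib Require Import Reals Arith.
From Coquelicot Require Import Coquelicot.

Open Scope C_scope.

Definition NtoC (n : nat) : C := RtoC (INR n).

Definition Cexp (z : C) : C :=
  (exp (Re z) * cos (Im z), exp (Re z) * sin (Im z))%R.

(* n ^ s for a complex exponent s (principal determination); used for n >= 1. *)
Definition Npowc (n : nat) (s : C) : C := Cexp (s * RtoC (ln (INR n))).

(* [zeta] is the Riemann zeta function: the Dirichlet series sum_(n >= 1) n ^ (-s)
   on the half-plane Re s > 1, continued to a holomorphic (complex
   differentiable) function on C minus the pole s = 1.  By the identity theorem
   this determines [zeta] everywhere except at s = 1, where its value is junk. *)
Definition is_riemann_zeta (zeta : C -> C) : Prop :=
  (forall s : C, (1 < Re s)%R ->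
     is_series (K := C_AbsRing) (V := C_NormedModule)
       (fun n : nat => Npowc (S n) (- s)) (zeta s)) /\
  (forall s : C, s <> 1 ->
     ex_derive (K := C_AbsRing) (V := C_NormedModule) zeta s).

Definition zeta_sub (zeta : C -> C) (c : nat) (s : C) : C :=
  (1 - Npowc c (1 - s)) * zeta s.

Definition acoef (c n : nat) : C :=
  if (n mod c =? 0)%nat then 1 - NtoC c else 1.

(* Sequences (b_n) indexed by n >= 1 are functions on nat whose value at 0 is
   never used: [cDelta c k b n] only involves indices >= n. *)
Fixpoint cDelta (c k : nat) (b : nat -> C) (n : nat) : C :=
  match k with
  | O => b n
  | S k' => sum_n_m (G := C_AbelianMonoid)
              (fun i : nat => acoef c i * cDelta c k' b (n + i)%nat) 1 c
  end.

Definition Npow_seq (m : nat) (n : nat) : C := NtoC n ^ m.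

(* Main.v *)
Require Import Defs.
From Stdlib Require Import Reals Arith Lra Lia Psatz Classical ClassicalEpsilon.
From Coquelicot Require Import Coquelicot.

Open Scope C_scope.

(** Write a_n for the periodic coefficients and Delta for the operator
    b |-> sum_(i <= c) a_i b_(n+i).  Since the convolution of one period of a
    with a is -c a, summation by parts gives
      c sum_(n <= N) a_n b_n + sum_(n <= N) a_n (Delta b)_n
        = X(b) + edge_N(b),
    where X(b) is the parenthesis of the formula (taken at j = 0) and edge_N(b)
    only involves b_(N+1), ..., b_(N+c) ([summation_by_parts]).  Iterating K + 1
    times writes sum_(n <= N) a_n b_n as a finite combination [approx] of the
    X(Delta^j b), j <= K, and of the partial sum of the series of
    a_n (Delta^(K+1) b)_n, up to edge terms ([twisted_sum_transform]).

    Take b_n = n^(-s).  For Re s > 1 the partial sums tend to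
    (1 - c^(1-s)) zeta(s) and the edge terms tend to 0, so [approx] tends to
    zeta_(c)(s), uniformly on Re s >= sigma > 1 ([zeta_sub_approx_uniform]).
    Because sum_(i <= c) a_i = 0, each Delta gains a factor of order 1/n:
    Delta^k n^(-s) is bounded by a multiple of |s (s+1) ... (s+k-1)| n^(-Re s-k)
    ([rDelta_decay]).  Hence for K large [approx] stays bounded, uniformly in N,
    on a prescribed compact set; and at s = -m the product vanishes for k > m, so
    that there [approx] does not depend on N and is the sum over j of the formula
    ([approx_neg_nat]).

    It remains to carry the limit from Re s > 1 to s = -m, knowing of zeta only
    that it is complex differentiable off s = 1.  With s = 1 + e^w the
    differences F_N(w) = zeta_(c)(s) - approx_N(s) are entire functions of w; they
    are uniformly bounded on a large rectangle, tend to 0 uniformly for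
    |Im w| <= 3/2 (where Re s > 1), and s = -m is w = ln(m+1) + i pi.
    Lemma [vanishing_propagates] extends the region of convergence upward in
    steps of height 1/2.  One step rests on the inequality
    |f(z0)| <= sup over a circle centred at z0 of |f| ([Cmod_center_le_circle]),
    applied to f times a high power of a polynomial of modulus less than 1 on the
    part of the circle where f is merely bounded.  That inequality follows from
    Goursat's theorem on rectangles, applied to w |-> f(z0 + e^w). *)

(** * Complex differentiability *)

Notation cdiff f z := (ex_derive (K := C_AbsRing) (V := C_NormedModule) f z).
Definition entire (f : C -> C) : Prop := forall z, cdiff f z.

(** The two normed-module structures on C have convertible operations but are
    different terms: the product rule and the chain rule produce the first one
    when the codomain is C as a ring, the statements below use the second. *)
Lemma is_derive_C_module (f : C -> C) (z l : C) :
  is_derive (K := C_AbsRing) (V := AbsRing_NormedModule C_AbsRing) f z l <->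
  is_derive (K := C_AbsRing) (V := C_NormedModule) f z l.
Proof.
  split; intros [_ H]; split.
  - exact (is_linear_scal_l (K := C_AbsRing) (V := C_NormedModule) l).
  - exact H.
  - exact (is_linear_scal_l (K := C_AbsRing) (V := AbsRing_NormedModule C_AbsRing) l).
  - exact H.
Qed.

Lemma cdiff_const (k z : C) : cdiff (fun _ => k) z.
Proof. apply ex_derive_const. Qed.

Lemma cdiff_id (z : C) : cdiff (fun w => w) z.
Proof. exists (RtoC 1). apply is_derive_C_module. exact (is_derive_id (K := C_AbsRing) z). Qed.

Lemma cdiff_plus (f g : C -> C) z : cdiff f z -> cdiff g z -> cdiff (fun w => f w + g w) z.
Proof. exact (ex_derive_plus (K := C_AbsRing) (V := C_NormedModule) f g z). Qed.

Lemma cdiff_minus (f g : C -> C) z : cdiff f z -> cdiff g z -> cdiff (fun w => f w - g w) z.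
Proof. exact (ex_derive_minus (K := C_AbsRing) (V := C_NormedModule) f g z). Qed.

Lemma cdiff_mult (f g : C -> C) z : cdiff f z -> cdiff g z -> cdiff (fun w => f w * g w) z.
Proof.
  intros [a Ha] [b Hb].
  exists (a * g z + f z * b).
  apply is_derive_C_module in Ha; apply is_derive_C_module in Hb.
  apply is_derive_C_module.
  exact (is_derive_mult (K := C_AbsRing) f g z a b Ha Hb Cmult_comm).
Qed.

Lemma cdiff_comp (f g : C -> C) z : cdiff f (g z) -> cdiff g z -> cdiff (fun w => f (g w)) z.
Proof.
  intros [a Ha] [b Hb]. apply is_derive_C_module in Hb.
  exists (b * a). exact (is_derive_comp (K := C_AbsRing) (V := C_NormedModule) f g z a b Ha Hb).
Qed.

Lemma cdiff_ext (f g : C -> C) z : (forall w, f w = g w) -> cdiff f z -> cdiff g z.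
Proof. intros E. now apply ex_derive_ext. Qed.

Lemma is_derive_C_estimate (f : C -> C) (z l : C) :
  is_derive (K := C_AbsRing) (V := C_NormedModule) f z l ->
  forall eps : R, (0 < eps)%R -> exists delta : R, (0 < delta)%R /\
    forall w, (Cmod (w - z) < delta)%R ->
      (Cmod (f w - f z - l * (w - z)) <= eps * Cmod (w - z))%R.
Proof.
  intros [_ H] eps Heps.
  destruct (H z (fun P HP => HP) (mkposreal eps Heps)) as [d Hd].
  exists d. split; [apply cond_pos|]. intros w Hw.
  specialize (Hd w Hw). rewrite (Cmult_comm l). exact Hd.
Qed.

Lemma is_derive_C_of_estimate (f : C -> C) (z l : C) :
  (forall eps : R, (0 < eps)%R -> exists delta : R, (0 < delta)%R /\
    forall w, (Cmod (w - z) < delta)%R ->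
      (Cmod (f w - f z - l * (w - z)) <= eps * Cmod (w - z))%R) ->
  is_derive (K := C_AbsRing) (V := C_NormedModule) f z l.
Proof.
  intros H. split.
  - exact (is_linear_scal_l (K := C_AbsRing) (V := C_NormedModule) l).
  - intros x Hx eps.
    assert (E : z = x) by exact (is_filter_lim_locally_unique (K:=C_AbsRing) (V:=AbsRing_NormedModule C_AbsRing) z x Hx).
    subst x.
    destruct (H eps (cond_pos eps)) as [d [Hd Hw]].
    exists (mkposreal d Hd). intros w Hb. specialize (Hw w Hb).
    rewrite (Cmult_comm l) in Hw. exact Hw.
Qed.

Lemma Cmod_le_Re_Im (z : C) : (Cmod z <= Rabs (Re z) + Rabs (Im z))%R.
Proof.
  destruct z as [x y]. simpl.
  replace (x, y) with (RtoC x + Ci * RtoC y) by (unfold Ci, RtoC, Cplus, Cmult; simpl; f_equal; ring).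
  eapply Rle_trans; [apply Cmod_triangle|].
  rewrite Cmod_mult, Cmod_Ci, !Cmod_R. lra.
Qed.

Lemma Im_le_Cmod (z : C) : (Rabs (Im z) <= Cmod z)%R.
Proof. eapply Rle_trans; [apply Rmax_r|apply (Rmax_Cmod z)]. Qed.

Lemma Cexp_plus (z w : C) : Cexp (z + w) = Cexp z * Cexp w.
Proof.
  unfold Cexp, Cmult; simpl. unfold Re, Im; simpl.
  rewrite exp_plus, cos_plus, sin_plus. f_equal; ring.
Qed.

Lemma Cexp_RtoC (x : R) : Cexp x = exp x.
Proof. unfold Cexp; simpl. rewrite cos_0, sin_0. unfold RtoC. f_equal; ring. Qed.

Lemma Cmod_Cexp (z : C) : Cmod (Cexp z) = exp (Re z).
Proof.
  replace (Cexp z) with (RtoC (exp (Re z)) * (cos (Im z), sin (Im z)))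
    by (unfold Cexp, RtoC, Cmult; simpl; f_equal; ring).
  rewrite Cmod_mult, Cmod_R, Rabs_pos_eq by (left; apply exp_pos).
  unfold Cmod; simpl.
  replace (_ + _)%R with ((Rsqr (sin (Im z)) + Rsqr (cos (Im z))))%R by (unfold Rsqr; ring).
  rewrite sin2_cos2, sqrt_1. ring.
Qed.

(** The upper bound comes from exp (-x) >= 1 - x, that is exp x <= 1 / (1 - x). *)
Lemma exp_quadratic (x : R) : (Rabs x <= 1/2 -> 0 <= exp x - 1 - x <= 2 * x ^ 2)%R.
Proof.
  intros Hx. apply Rabs_le_between in Hx.
  split; [pose proof (exp_ineq1_le x); lra|].
  pose proof (exp_ineq1_le (- x)) as H. rewrite exp_Ropp in H.
  pose proof (exp_pos x) as Hp.
  assert (H1 : (exp x * (1 - x) <= 1)%R).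
  { apply Rmult_le_compat_l with (r := exp x) in H; [|lra].
    rewrite Rinv_r in H by lra. lra. }
  apply Rmult_le_reg_r with (1 - x)%R; [lra|]. nra.
Qed.

Lemma Rabs_sin_le (x : R) : (Rabs (sin x) <= Rabs x)%R.
Proof.
  destruct (MVT_gen sin 0 x cos) as [c [_ E]].
  - intros y _. apply is_derive_sin.
  - intros y _. apply continuity_sin.
  - rewrite sin_0 in E. replace (sin x) with (cos c * x)%R by lra.
    rewrite Rabs_mult. pose proof (Rabs_pos x).
    assert (Rabs (cos c) <= 1)%R by (apply Rabs_le; pose proof (COS_bound c); lra). nra.
Qed.

Lemma cos_quadratic (x : R) : (0 <= 1 - cos x <= x ^ 2 / 2)%R.
Proof.
  split; [pose proof (COS_bound x); lra|].
  replace x with (2 * (x / 2))%R at 1 by field.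
  rewrite cos_2a_sin.
  pose proof (Rabs_sin_le (x / 2)) as H.
  apply Rsqr_le_abs_1 in H. unfold Rsqr in H. lra.
Qed.

Lemma sin_quadratic (x : R) : (Rabs x <= 1 -> Rabs (sin x - x) <= x ^ 2)%R.
Proof.
  intros Hx.
  destruct (MVT_gen (fun y => sin y - y)%R 0 x (fun y => cos y - 1)%R) as [c [Hc E]].
  - intros y _. auto_derive; trivial. ring.
  - intros y _. apply continuity_pt_minus; [apply continuity_sin|apply continuity_pt_id].
  - rewrite sin_0 in E. replace (sin x - x)%R with ((cos c - 1) * x)%R by lra.
    rewrite Rabs_mult.
    assert (Hcx : (Rabs c <= Rabs x)%R).
    { destruct (Rle_dec 0 x).
      - rewrite Rmin_left, Rmax_right in Hc by lra. rewrite !Rabs_pos_eq; lra.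
      - rewrite Rmin_right, Rmax_left in Hc by lra. rewrite !Rabs_left1; lra. }
    pose proof (cos_quadratic c) as Hq.
    rewrite (Rabs_left1 (cos c - 1)) by lra.
    rewrite <- (pow2_abs c) in Hq. rewrite <- (pow2_abs x).
    pose proof (Rabs_pos x). pose proof (Rabs_pos c).
    assert (1 - cos c <= Rabs x)%R by nra. nra.
Qed.

Lemma Cexp_quadratic (h : C) :
  (Cmod h <= 1/2 -> Cmod (Cexp h - 1 - h) <= 8 * Cmod h ^ 2)%R.
Proof.
  intros Hh. eapply Rle_trans; [apply Cmod_le_Re_Im|].
  pose proof (re_le_Cmod h) as Hx. pose proof (Im_le_Cmod h) as Hy.
  set (r := Cmod h) in *. destruct h as [x y]. simpl in Hx, Hy. unfold Cexp; simpl.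
  pose proof (exp_quadratic x ltac:(lra)) as He.
  pose proof (cos_quadratic y) as Hc.
  pose proof (sin_quadratic y ltac:(lra)) as Hs.
  assert (Hr : (0 <= r)%R) by apply Cmod_ge_0.
  assert (x ^ 2 <= r ^ 2)%R by (rewrite <- (pow2_abs x); pose proof (Rabs_pos x); nra).
  assert (y ^ 2 <= r ^ 2)%R by (rewrite <- (pow2_abs y); pose proof (Rabs_pos y); nra).
  apply Rabs_le_between in Hx. 
  assert (He0 := exp_pos x).
  assert (He2 : (exp x <= 2)%R) by nra.
  replace (exp x * cos y + - (1) + - x)%R with ((exp x - 1 - x) + exp x * (- (1 - cos y)))%R by ring.
  replace (exp x * sin y + - 0 + - y)%R with (exp x * (sin y - y) + y * (exp x - 1))%R by ring.
  assert (A1 : (Rabs (exp x - 1 - x + exp x * - (1 - cos y)) <= 4 * r ^ 2)%R) by (apply Rabs_le; split; nra).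
  assert (A2 : (Rabs (exp x * (sin y - y)) <= 2 * r ^ 2)%R).
  { rewrite Rabs_mult, (Rabs_pos_eq (exp x)) by lra. pose proof (Rabs_pos (sin y - y)). nra. }
  assert (A3 : (Rabs (y * (exp x - 1)) <= 2 * r ^ 2)%R).
  { rewrite Rabs_mult.
    assert (Rabs (exp x - 1) <= 2 * r)%R by (apply Rabs_le; split; nra).
    pose proof (Rabs_pos y). pose proof (Rabs_pos (exp x - 1)). nra. }
  pose proof (Rabs_triang (exp x * (sin y - y)) (y * (exp x - 1))). nra.
Qed.

Lemma entire_Cexp : entire Cexp.
Proof.
  intros z. exists (Cexp z). apply is_derive_C_of_estimate. intros eps Heps.
  pose proof (exp_pos (Re z)) as He. 
  assert (Hq : (0 < eps / (8 * exp (Re z)))%R) by (apply Rdiv_lt_0_compat; lra).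
  exists (Rmin (1/2) (eps / (8 * exp (Re z)))). split; [apply Rmin_pos; lra|].
  intros w Hw. set (h := w - z) in *.
  assert (H1 : (Cmod h < 1/2)%R) by (eapply Rlt_le_trans; [apply Hw|apply Rmin_l]).
  assert (H2 : (Cmod h < eps / (8 * exp (Re z)))%R) by (eapply Rlt_le_trans; [apply Hw|apply Rmin_r]).
  replace w with (z + h) by (unfold h; ring).
  replace (Cexp (z + h) - Cexp z - Cexp z * h) with (Cexp z * (Cexp h - 1 - h))
    by (rewrite Cexp_plus; ring).
  rewrite Cmod_mult, Cmod_Cexp.
  pose proof (Cexp_quadratic h ltac:(lra)) as H3. pose proof (Cmod_ge_0 h).
  apply Rle_trans with (exp (Re z) * (8 * Cmod h ^ 2))%R; [apply Rmult_le_compat_l; lra|].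
  apply Rlt_le in H2. apply Rmult_le_compat_r with (r := (8 * exp (Re z))%R) in H2; [|lra].
  unfold Rdiv in H2. rewrite Rmult_assoc, Rinv_l in H2 by lra. nra.
Qed.

(** * Goursat's theorem and the centre of a circle *)

(** Bisection in both directions: a counterexample would contain a counterexample
    of half the size, and so on; the nested rectangles shrink to a point,
    contradicting the local hypothesis there.  All rectangles are homothetic to
    L x H, with lower left corner (x, y) and scale t, so that a perimeter times a
    diameter is controlled by t^2, which is additive under the subdivision. *)
Lemma rectangle_subdivision_induction (L H : R) (P : R -> R -> R -> Prop) :
  (0 <= L)%R -> (0 <= H)%R ->
  (forall x y t, (0 < t)%R ->
     P x y (t / 2)%R -> P (x + t / 2 * L)%R y (t / 2)%R ->
     P x (y + t / 2 * H)%R (t / 2)%R -> P (x + t / 2 * L)%R (y + t / 2 * H)%R (t / 2)%R ->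
     P x y t) ->
  (forall x0 y0, exists eps, (0 < eps)%R /\
     forall x y t, (0 < t < eps)%R -> (x <= x0 <= x + t * L)%R -> (y <= y0 <= y + t * H)%R ->
       P x y t) ->
  forall x y, P x y 1%R.
Proof.
  intros HL HH Hquad Hloc x1 y1. apply NNPP. intros Hbad.
  (* next n p q: q is the corner of a bad quarter of the bad rectangle of corner p *)
  pose (next := fun (n : nat) (p q : R * R) =>
    let t := ((/ 2) ^ n)%R in
    ~ P (fst p) (snd p) t ->
    ~ P (fst q) (snd q) (t / 2)%R /\
    (fst p <= fst q <= fst p + t / 2 * L)%R /\ (snd p <= snd q <= snd p + t / 2 * H)%R).
  assert (Hnext : forall n p, exists q, next n p q).
  { intros n [x y]. unfold next; simpl. set (t := ((/ 2) ^ n)%R).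
    assert (Ht : (0 < t)%R) by (apply pow_lt; lra).
    assert (0 <= t / 2 * L)%R by (apply Rmult_le_pos; lra).
    assert (0 <= t / 2 * H)%R by (apply Rmult_le_pos; lra).
    apply NNPP. intros Hno.
    apply Hno. exists (x, y). intros Hp. exfalso.
    apply Hp. apply (Hquad x y t Ht); apply NNPP; intros Hq; apply Hno.
    - exists (x, y). intros _. simpl. repeat split; try lra; exact Hq.
    - exists (x + t / 2 * L, y)%R. intros _. simpl. repeat split; try lra; exact Hq.
    - exists (x, y + t / 2 * H)%R. intros _. simpl. repeat split; try lra; exact Hq.
    - exists (x + t / 2 * L, y + t / 2 * H)%R. intros _. simpl. repeat split; try lra; exact Hq. }
  pose (u := fix u (n : nat) : R * R := match n with
    | O => (x1, y1)
    | S k => proj1_sig (constructive_indefinite_description _ (Hnext k (u k)))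
    end).
  assert (Hu : forall n, next n (u n) (u (S n))).
  { intros n. simpl. apply proj2_sig. }
  assert (Hn : forall n, ~ P (fst (u n)) (snd (u n)) ((/ 2) ^ n)%R).
  { induction n as [|n IH]; [exact Hbad|].
    destruct (Hu n IH) as [Q _]. simpl pow. rewrite Rmult_comm. exact Q. }
  assert (Hlim : forall (v : nat -> R) (l : R), (0 <= l)%R ->
     (forall n, (v n <= v (S n) <= v n + (/ 2) ^ n / 2 * l)%R) ->
     exists v0, forall n, (v n <= v0 <= v n + (/ 2) ^ n * l)%R).
  { intros v l Hl Hv.
    assert (Hup : forall n k, (v n <= v (n + k)%nat)%R).
    { intros n k. induction k as [|k IH]; [rewrite Nat.add_0_r; lra|].
      rewrite Nat.add_succ_r. specialize (Hv (n + k)%nat). lra. }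
    assert (Hdn : forall n k, (v (n + k)%nat + (/ 2) ^ (n + k) * l <= v n + (/ 2) ^ n * l)%R).
    { intros n k. induction k as [|k IH]; [rewrite Nat.add_0_r; lra|].
      rewrite Nat.add_succ_r. specialize (Hv (n + k)%nat). simpl pow. lra. }
    assert (Hpos : forall n, (0 <= (/ 2) ^ n * l)%R).
    { intros n. apply Rmult_le_pos; [apply pow_le; lra|exact Hl]. }
    assert (Hcross : forall n k, (v k <= v n + (/ 2) ^ n * l)%R).
    { intros n k. destruct (le_ge_dec n k) as [E|E].
      - replace k with (n + (k - n))%nat by lia.
        specialize (Hdn n (k - n)%nat). specialize (Hpos (n + (k - n))%nat). lra.
      - specialize (Hup k (n - k)%nat). replace (k + (n - k))%nat with n in Hup by lia.
        specialize (Hpos n). lra. }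
    destruct (completeness (fun z => exists k, z = v k)) as [v0 [Hub Hlub]].
    - exists (v 0%nat + (/ 2) ^ 0 * l)%R. intros z [k ->]. apply Hcross.
    - exists (v 0%nat), 0%nat. reflexivity.
    - exists v0. intros n. split; [apply Hub; now exists n|].
      apply Hlub. intros z [k ->]. apply Hcross. }
  destruct (Hlim (fun n => fst (u n)) L HL) as [x0 Hx0].
  { intros n. destruct (Hu n (Hn n)) as [_ [Q _]]. exact Q. }
  destruct (Hlim (fun n => snd (u n)) H HH) as [y0 Hy0].
  { intros n. destruct (Hu n (Hn n)) as [_ [_ Q]]. exact Q. }
  destruct (Hloc x0 y0) as [eps [Heps Hsmall]].
  destruct (pow_lt_1_zero (/ 2) ltac:(rewrite Rabs_pos_eq; lra) eps Heps) as [n Hpow].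
  specialize (Hpow n (Nat.le_refl n)).
  assert (Hp : (0 < (/ 2) ^ n)%R) by (apply pow_lt; lra).
  rewrite Rabs_pos_eq in Hpow by lra.
  apply (Hn n). apply Hsmall; auto.
Qed.

Notation CRInt := (RInt (V := C_R_CompleteNormedModule)).
Notation ex_CRInt := (ex_RInt (V := C_R_CompleteNormedModule)).

Definition bdry_int (f : C -> C) (a b c d : R) : C :=
  CRInt (fun x => f (x, c)) a b - CRInt (fun x => f (x, d)) a b
  + Ci * (CRInt (fun y => f (b, y)) c d - CRInt (fun y => f (a, y)) c d).

(** Continuity in terms of [Cmod], independent of the several uniform structures
    on C. *)
Definition Ccont (f : C -> C) : Prop :=
  forall z (eps : R), (0 < eps)%R -> exists delta, (0 < delta)%R /\
    forall w, (Cmod (w - z) < delta)%R -> (Cmod (f w - f z) < eps)%R.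

Lemma entire_Ccont f : entire f -> Ccont f.
Proof.
  intros Hf z eps Heps. destruct (Hf z) as [l Hl].
  destruct (is_derive_C_estimate _ _ _ Hl 1%R Rlt_0_1) as [d [Hd H]].
  pose proof (Cmod_ge_0 l) as Hl0.
  assert (Hq : (0 < eps / (2 + Cmod l))%R) by (apply Rdiv_lt_0_compat; lra).
  exists (Rmin d (eps / (2 + Cmod l))). split; [now apply Rmin_pos|].
  intros w Hw.
  assert (H1 : (Cmod (w - z) < d)%R) by (eapply Rlt_le_trans; [apply Hw|apply Rmin_l]).
  assert (H2 : (Cmod (w - z) < eps / (2 + Cmod l))%R) by (eapply Rlt_le_trans; [apply Hw|apply Rmin_r]).
  specialize (H w H1).
  replace (f w - f z) with ((f w - f z - l * (w - z)) + l * (w - z)) by ring.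
  eapply Rle_lt_trans; [apply Cmod_triangle|]. rewrite Cmod_mult.
  apply Rmult_lt_compat_r with (r := (2 + Cmod l)%R) in H2; [|lra].
  unfold Rdiv in H2. rewrite Rmult_assoc, Rinv_l in H2 by lra.
  pose proof (Cmod_ge_0 (w - z)). nra.
Qed.

Lemma Ccont_line f (g : R -> C) (M : R) : Ccont f -> (0 < M)%R ->
  (forall s t, (Cmod (g s - g t) <= M * Rabs (s - t))%R) ->
  forall t, continuous (U := C_R_CompleteNormedModule) (fun t => f (g t)) t.
Proof.
  intros Hf HM Hg t. apply filterlim_locally. intros eps.
  destruct (Hf (g t) eps (cond_pos eps)) as [d [Hd H]].
  assert (Hq : (0 < d / M)%R) by (apply Rdiv_lt_0_compat; lra).
  exists (mkposreal _ Hq). intros s Hs.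
  apply C_NormedModule_mixin_compat1.
  apply H. eapply Rle_lt_trans; [apply Hg|].
  change (Rabs (s - t) < d / M)%R in Hs.
  apply Rmult_lt_compat_r with (r := M) in Hs; [|lra].
  unfold Rdiv in Hs. rewrite Rmult_assoc, Rinv_l in Hs by lra. lra.
Qed.

Lemma ex_CRInt_hline f c : Ccont f -> forall a b, ex_CRInt (fun x => f (x, c)) a b.
Proof.
  intros Hf a b. apply (ex_RInt_continuous (V := C_R_CompleteNormedModule)). intros z _.
  apply (Ccont_line f (fun x => (x, c)) 1 Hf Rlt_0_1).
  intros s t. replace ((s, c) - (t, c)) with (RtoC (s - t))
    by (unfold RtoC, Cminus, Cplus, Copp; simpl; f_equal; ring).
  rewrite Cmod_R. lra.
Qed.

Lemma ex_CRInt_vline f c : Ccont f -> forall a b, ex_CRInt (fun y => f (c, y)) a b.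
Proof.
  intros Hf a b. apply (ex_RInt_continuous (V := C_R_CompleteNormedModule)). intros z _.
  apply (Ccont_line f (fun x => (c, x)) 1 Hf Rlt_0_1).
  intros s t. replace ((c, s) - (c, t)) with (Ci * RtoC (s - t))
    by (unfold RtoC, Ci, Cminus, Cplus, Copp, Cmult; simpl; f_equal; ring).
  rewrite Cmod_mult, Cmod_Ci, Cmod_R. lra.
Qed.

Lemma CRInt_Chasles (f : R -> C) a b c : ex_CRInt f a b -> ex_CRInt f b c ->
  CRInt f a c = CRInt f a b + CRInt f b c.
Proof. intros H1 H2. symmetry. exact (RInt_Chasles (V := C_R_CompleteNormedModule) f a b c H1 H2). Qed.

Lemma bdry_int_split f x m x' y n y' : Ccont f ->
  bdry_int f x x' y y' =
  bdry_int f x m y n + bdry_int f m x' y n + bdry_int f x m n y' + bdry_int f m x' n y'.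
Proof.
  intros Hf. unfold bdry_int.
  pose proof (ex_CRInt_hline f) as Hh. pose proof (ex_CRInt_vline f) as Hv.
  rewrite (CRInt_Chasles (fun t => f (t, y)) x m x'),
   (CRInt_Chasles (fun t => f (t, y')) x m x'),
   (CRInt_Chasles (fun t => f (x', t)) y n y'),
   (CRInt_Chasles (fun t => f (x, t)) y n y') by auto.
  ring.
Qed.

Lemma CRInt_le (f : R -> C) a b M : (a <= b)%R -> ex_CRInt f a b ->
  (forall x, (a <= x <= b)%R -> (Cmod (f x) <= M)%R) ->
  (Cmod (CRInt f a b) <= (b - a) * M)%R.
Proof.
  intros Hab He HM. rewrite Cmod_norm.
  apply (norm_RInt_le_const (V := C_R_NormedModule) f a b _ M Hab).
  - intros x Hx. specialize (HM x Hx). rewrite Cmod_norm in HM. exact HM.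
  - exact (RInt_correct (V := C_R_CompleteNormedModule) f a b He).
Qed.

Lemma bdry_int_le f a b c d M : Ccont f -> (a <= b)%R -> (c <= d)%R ->
  (forall z, (a <= Re z <= b)%R -> (c <= Im z <= d)%R -> (Cmod (f z) <= M)%R) ->
  (Cmod (bdry_int f a b c d) <= 2 * ((b - a) + (d - c)) * M)%R.
Proof.
  intros Hf Hab Hcd HM. unfold bdry_int.
  assert (H1 := CRInt_le (fun t => f (t, c)) a b M Hab (ex_CRInt_hline f c Hf a b)
    ltac:(intros; apply HM; simpl; lra)).
  assert (H2 := CRInt_le (fun t => f (t, d)) a b M Hab (ex_CRInt_hline f d Hf a b)
    ltac:(intros; apply HM; simpl; lra)).
  assert (H3 := CRInt_le (fun t => f (b, t)) c d M Hcd (ex_CRInt_vline f b Hf c d)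
    ltac:(intros; apply HM; simpl; lra)).
  assert (H4 := CRInt_le (fun t => f (a, t)) c d M Hcd (ex_CRInt_vline f a Hf c d)
    ltac:(intros; apply HM; simpl; lra)).
  eapply Rle_trans; [apply Cmod_triangle|]. rewrite Cmod_mult, Cmod_Ci.
  pose proof (Cmod_triangle (CRInt (fun t => f (t, c)) a b) (- CRInt (fun t => f (t, d)) a b)) as T1.
  pose proof (Cmod_triangle (CRInt (fun t => f (b, t)) c d) (- CRInt (fun t => f (a, t)) c d)) as T2.
  rewrite Cmod_opp in T1, T2. unfold Cminus. lra.
Qed.

Lemma bdry_int_minus f g a b c d : Ccont f -> Ccont g ->
  bdry_int (fun z => f z - g z) a b c d = bdry_int f a b c d - bdry_int g a b c d.
Proof.
  intros Hf Hg. unfold bdry_int.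
  assert (E : forall u v x y, ex_CRInt u x y -> ex_CRInt v x y ->
    CRInt (fun t => u t - v t) x y = CRInt u x y - CRInt v x y).
  { intros u v x y Hu Hv. exact (RInt_minus (V := C_R_CompleteNormedModule) u v x y Hu Hv). }
  pose proof (ex_CRInt_hline f) as Hh. pose proof (ex_CRInt_vline f) as Hv.
  pose proof (ex_CRInt_hline g) as Hh'. pose proof (ex_CRInt_vline g) as Hv'.
  rewrite (E (fun x => f (x, c)) (fun x => g (x, c))),
    (E (fun x => f (x, d)) (fun x => g (x, d))),
    (E (fun x => f (b, x)) (fun x => g (b, x))),
    (E (fun x => f (a, x)) (fun x => g (a, x))) by auto.
  ring.
Qed.

Lemma CRInt_affine (k l : C) (a b : R) :
  CRInt (fun t => k + RtoC t * l) a b =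
  RtoC (b - a) * k + RtoC ((b ^ 2 - a ^ 2) / 2) * l.
Proof.
  apply (is_RInt_unique (V := C_R_CompleteNormedModule)).
  assert (Hd : forall x : R, is_derive (V := C_R_NormedModule)
    (fun t : R => RtoC t * k + RtoC (t ^ 2 / 2) * l) x (k + RtoC x * l)).
  { intros x.
    apply (is_derive_ext (V := C_R_NormedModule) (fun t : R => plus (scal t k) (scal (t ^ 2 / 2)%R l))).
    { intros t. rewrite !scal_R_Cmult. reflexivity. }
    replace (k + RtoC x * l) with (plus (scal 1%R k) (scal x l)).
    2:{ rewrite !scal_R_Cmult. change (RtoC 1 * k + RtoC x * l = k + RtoC x * l). ring. }
    apply (is_derive_plus (V := C_R_NormedModule)).
    - apply (is_derive_scal_l (K := R_AbsRing) (V := C_R_NormedModule) (fun t : R => t)).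
      exact (is_derive_id (K := R_AbsRing) x).
    - apply (is_derive_scal_l (K := R_AbsRing) (V := C_R_NormedModule) (fun t : R => (t ^ 2 / 2)%R)).
      auto_derive; trivial. field. }
  replace (RtoC (b - a) * k + RtoC ((b ^ 2 - a ^ 2) / 2) * l) with
    (minus (G := C_R_CompleteNormedModule) (RtoC b * k + RtoC (b ^ 2 / 2) * l) (RtoC a * k + RtoC (a ^ 2 / 2) * l)).
  2:{ change (RtoC b * k + RtoC (b ^ 2 / 2) * l - (RtoC a * k + RtoC (a ^ 2 / 2) * l) =
       RtoC (b - a) * k + RtoC ((b ^ 2 - a ^ 2) / 2) * l).
      replace ((b ^ 2 - a ^ 2) / 2)%R with (b ^ 2 / 2 - a ^ 2 / 2)%R by field.
      rewrite !RtoC_minus. ring. }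
  apply (is_RInt_derive (V := C_R_CompleteNormedModule) (fun t : R => RtoC t * k + RtoC (t ^ 2 / 2) * l)).
  - intros x _. apply Hd.
  - intros x _. apply (Ccont_line (fun z => z) (fun t => k + RtoC t * l) (1 + Cmod l)).
    + intros z eps He. exists eps. split; auto.
    + pose proof (Cmod_ge_0 l). lra.
    + intros s t. replace (_ - _) with (RtoC (s - t) * l) by (rewrite RtoC_minus; ring).
      rewrite Cmod_mult, Cmod_R. pose proof (Rabs_pos (s - t)). nra.
Qed.

Lemma CRInt_ext (f g : R -> C) a b : (forall x, f x = g x) -> CRInt f a b = CRInt g a b.
Proof. intros E. apply (RInt_ext (V := C_R_CompleteNormedModule)). intros; apply E. Qed.

Lemma C_pair (x y : R) : (x, y) = RtoC x + Ci * RtoC y.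
Proof. unfold Ci, RtoC, Cplus, Cmult; simpl; f_equal; ring. Qed.

Lemma bdry_int_affine (k l : C) a b c d : bdry_int (fun z => k + l * z) a b c d = 0.
Proof.
  assert (Hh : forall y, CRInt (fun x => k + l * (x, y)) a b =
     RtoC (b - a) * (k + l * Ci * RtoC y) + RtoC ((b ^ 2 - a ^ 2) / 2) * l).
  { intros y. rewrite <- CRInt_affine. apply CRInt_ext. intros x.
    rewrite (C_pair x y). ring. }
  assert (Hv : forall x, CRInt (fun y => k + l * (x, y)) c d =
     RtoC (d - c) * (k + l * RtoC x) + RtoC ((d ^ 2 - c ^ 2) / 2) * (l * Ci)).
  { intros x. rewrite <- CRInt_affine. apply CRInt_ext. intros y.
    rewrite (C_pair x y). ring. }
  unfold bdry_int. rewrite !Hh, !Hv, !RtoC_minus. ring.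
Qed.

(** Near z0 the function is affine up to eps |z - z0|, and affine functions have
    boundary integral 0; the boundary integral over a small rectangle of scale t is
    therefore at most eps times a constant times t^2.  This bound survives
    subdivision, and eps is arbitrary. *)
Lemma Goursat f a b c d : entire f -> (a <= b)%R -> (c <= d)%R -> bdry_int f a b c d = 0.
Proof.
  intros Hf Hab Hcd. pose proof (entire_Ccont f Hf) as Hc.
  set (L := (b - a)%R). set (H := (d - c)%R).
  assert (HL : (0 <= L)%R) by (unfold L; lra). assert (HH : (0 <= H)%R) by (unfold H; lra).
  assert (Hsmall : forall eps, (0 < eps)%R ->
    (Cmod (bdry_int f a b c d) <= eps * (2 * (L + H) ^ 2))%R).
  { intros eps Heps.
    pose (P := fun x y t => (Cmod (bdry_int f x (x + t * L) y (y + t * H))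
      <= eps * (2 * (L + H) ^ 2) * t ^ 2)%R).
    assert (HP : P a c 1%R).
    { apply (rectangle_subdivision_induction L H P HL HH).
      - intros x y t Ht H1 H2 H3 H4. unfold P in *.
        rewrite (bdry_int_split f x (x + t / 2 * L) (x + t * L) y (y + t / 2 * H) (y + t * H) Hc).
        replace (x + t / 2 * L + t / 2 * L)%R with (x + t * L)%R in H2, H4 by field.
        replace (y + t / 2 * H + t / 2 * H)%R with (y + t * H)%R in H3, H4 by field.
        eapply Rle_trans; [apply Cmod_triangle|].
        eapply Rle_trans; [apply Rplus_le_compat_r, Cmod_triangle|].
        eapply Rle_trans; [apply Rplus_le_compat_r, Rplus_le_compat_r, Cmod_triangle|].
        replace (eps * (2 * (L + H) ^ 2) * t ^ 2)%R with
          (4 * (eps * (2 * (L + H) ^ 2) * (t / 2) ^ 2))%R by field.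
        lra.
      - intros x0 y0. set (z0 := (x0, y0) : C).
        destruct (Hf z0) as [l Hl].
        destruct (is_derive_C_estimate _ _ _ Hl eps Heps) as [dl [Hdl Hest]].
        assert (Hq : (0 < dl / (L + H + 1))%R) by (apply Rdiv_lt_0_compat; lra).
        exists (dl / (L + H + 1))%R. split; [exact Hq|].
        intros x y t [Ht Htd] Hx Hy. unfold P.
        apply Rmult_lt_compat_r with (r := (L + H + 1)%R) in Htd; [|lra].
        unfold Rdiv in Htd. rewrite Rmult_assoc, Rinv_l in Htd by lra.
        assert (HtL : (0 <= t * L)%R) by (apply Rmult_le_pos; lra).
        assert (HtH : (0 <= t * H)%R) by (apply Rmult_le_pos; lra).
        assert (Hca : Ccont (fun z => (f z0 - l * z0) + l * z)).
        { apply entire_Ccont. intros z. apply cdiff_plus; [apply cdiff_const|].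
          apply cdiff_mult; [apply cdiff_const|apply cdiff_id]. }
        replace (bdry_int f x (x + t * L) y (y + t * H)) with
          (bdry_int (fun z => f z - ((f z0 - l * z0) + l * z)) x (x + t * L) y (y + t * H))
          by (rewrite bdry_int_minus, bdry_int_affine by auto; ring).
        assert (Hcd' : Ccont (fun z => f z - ((f z0 - l * z0) + l * z))).
        { apply entire_Ccont. intros z.
          apply (cdiff_ext (fun z => f z + ((- (f z0 - l * z0)) + (- l) * z))).
          - intros w. ring.
          - apply cdiff_plus; [apply Hf|]. apply cdiff_plus; [apply cdiff_const|].
            apply cdiff_mult; [apply cdiff_const|apply cdiff_id]. }
        eapply Rle_trans.
        { apply bdry_int_le with (M := (eps * (t * L + t * H))%R); [exact Hcd'|lra|lra|].
          intros z Hzx Hzy.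
          assert (Hzz : (Cmod (z - z0) <= t * L + t * H)%R).
          { eapply Rle_trans; [apply Cmod_le_Re_Im|]. unfold z0; simpl.
            apply Rplus_le_compat; apply Rabs_le; unfold Re, Im in *; lra. }
          replace (f z - (f z0 - l * z0 + l * z)) with (f z - f z0 - l * (z - z0)) by ring.
          eapply Rle_trans; [apply Hest; lra|]. apply Rmult_le_compat_l; lra. }
        right. ring. }
    unfold P, L, H in HP. replace (a + 1 * (b - a))%R with b in HP by ring.
    replace (c + 1 * (d - c))%R with d in HP by ring. unfold L, H. lra. }
  apply Cmod_eq_0. apply Rle_antisym; [|apply Cmod_ge_0].
  apply le_epsilon. intros e He.
  assert (Hk : (0 <= 2 * (L + H) ^ 2)%R) by nra.
  specialize (Hsmall (e / (2 * (L + H) ^ 2 + 1))%R ltac:(apply Rdiv_lt_0_compat; lra)).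
  eapply Rle_trans; [apply Hsmall|].
  apply Rmult_le_reg_r with (2 * (L + H) ^ 2 + 1)%R; [lra|].
  replace (e / (2 * (L + H) ^ 2 + 1) * (2 * (L + H) ^ 2) * (2 * (L + H) ^ 2 + 1))%R
    with (e * (2 * (L + H) ^ 2))%R by (field; lra). nra.
Qed.

Lemma Ccont_bounded f a b c d : Ccont f -> (a <= b)%R -> (c <= d)%R ->
  exists M, forall z, (a <= Re z <= b)%R -> (c <= Im z <= d)%R -> (Cmod (f z) <= M)%R.
Proof.
  intros Hf Hab Hcd.
  pose (P := fun x y t => exists M, forall z,
    (x <= Re z <= x + t * (b - a))%R -> (y <= Im z <= y + t * (d - c))%R -> (Cmod (f z) <= M)%R).
  assert (HP : P a c 1%R).
  { apply (rectangle_subdivision_induction (b - a) (d - c) P); [lra|lra| |].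
    - intros x y t Ht [M1 H1] [M2 H2] [M3 H3] [M4 H4].
      exists (Rmax (Rmax M1 M2) (Rmax M3 M4)). intros z Hx Hy.
      pose proof (Rmax_l (Rmax M1 M2) (Rmax M3 M4)). pose proof (Rmax_r (Rmax M1 M2) (Rmax M3 M4)).
      pose proof (Rmax_l M1 M2). pose proof (Rmax_r M1 M2).
      pose proof (Rmax_l M3 M4). pose proof (Rmax_r M3 M4).
      destruct (Rle_dec (Re z) (x + t / 2 * (b - a))), (Rle_dec (Im z) (y + t / 2 * (d - c))).
      + specialize (H1 z). lra.
      + specialize (H3 z). lra.
      + specialize (H2 z). lra.
      + specialize (H4 z). lra.
    - intros x0 y0. destruct (Hf (x0, y0) 1%R Rlt_0_1) as [dl [Hdl H]].
      exists (dl / (b - a + (d - c) + 1))%R. split; [apply Rdiv_lt_0_compat; lra|].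
      intros x y t [Ht Htd] Hx Hy. exists (1 + Cmod (f (x0, y0)))%R. intros z Hzx Hzy.
      apply Rmult_lt_compat_r with (r := (b - a + (d - c) + 1)%R) in Htd; [|lra].
      unfold Rdiv in Htd. rewrite Rmult_assoc, Rinv_l in Htd by lra.
      assert (Hzz : (Cmod (z - (x0, y0)) < dl)%R).
      { eapply Rle_lt_trans; [apply Cmod_le_Re_Im|].
        apply Rle_lt_trans with (t * (b - a) + t * (d - c))%R; [|lra]. simpl.
        apply Rplus_le_compat; apply Rabs_le; unfold Re, Im in *; lra. }
      specialize (H z Hzz).
      replace (f z) with ((f z - f (x0, y0)) + f (x0, y0)) by ring.
      eapply Rle_trans; [apply Cmod_triangle|]. lra. }
  destruct HP as [M HM]. exists M. intros z Hx Hy. apply HM; lra.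
Qed.

(** In the coordinate w of z = z0 + e^w, Goursat's theorem on the rectangle
    [ln r', ln r] x [0, 2 pi] compares the means of f over the circles of radii r'
    and r, because the horizontal sides cancel by periodicity; as r' tends to 0
    the mean tends to f(z0). *)
Lemma Cmod_center_le_circle f z0 r M : entire f -> (0 < r)%R ->
  (forall z, Cmod (z - z0) = r -> (Cmod (f z) <= M)%R) -> (Cmod (f z0) <= M)%R.
Proof.
  intros Hf Hr HM.
  set (K := fun w => f (z0 + Cexp w)).
  assert (HK : entire K).
  { intros w. apply (cdiff_comp f (fun w => z0 + Cexp w)); [apply Hf|].
    apply cdiff_plus; [apply cdiff_const|apply entire_Cexp]. }
  pose proof (entire_Ccont f Hf) as Hc. pose proof (entire_Ccont K HK) as HKc.
  pose proof PI_RGT_0 as Hpi.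
  apply le_epsilon. intros e He.
  destruct (Hc z0 e He) as [dl [Hdl Hd]].
  set (r' := Rmin r (dl / 2)).
  assert (Hr' : (0 < r')%R) by (apply Rmin_pos; lra).
  assert (Hrr : (r' <= r)%R) by apply Rmin_l.
  assert (Hrd : (r' < dl)%R) by (eapply Rle_lt_trans; [apply Rmin_r|lra]).
  assert (Hln : (ln r' <= ln r)%R) by (apply ln_le; lra).
  pose proof (Goursat K (ln r') (ln r) 0 (2 * PI) HK Hln ltac:(lra)) as G.
  unfold bdry_int in G.
  (* the horizontal sides cancel by periodicity of exp *)
  rewrite (CRInt_ext (fun x => K (x, 2 * PI)%R) (fun x => K (x, 0%R))) in G.
  2:{ intros x. unfold K, Cexp, Re, Im; simpl fst; simpl snd.
      now rewrite cos_2PI, sin_2PI, cos_0, sin_0. }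
  set (A := CRInt (fun y => K (ln r, y)) 0 (2 * PI) : C) in G.
  set (B := CRInt (fun y => K (ln r', y)) 0 (2 * PI) : C) in G.
  set (D := CRInt (fun x => K (x, 0%R)) (ln r') (ln r) : C) in G.
  assert (G' : Ci * (A - B) = 0) by (rewrite <- G; ring).
  assert (EAB : A = B).
  { replace A with (B - Ci * (Ci * (A - B))).
    2:{ replace (B - Ci * (Ci * (A - B))) with (B - (Ci * Ci) * (A - B)) by ring.
        replace (Ci * Ci) with (- (1)) by (apply injective_projections; simpl; ring). ring. }
    rewrite G'. ring. }
  assert (HA : (Cmod A <= (2 * PI - 0) * M)%R).
  { apply CRInt_le; [lra|apply ex_CRInt_vline; exact HKc|]. intros y _. unfold K. apply HM.
    replace (z0 + Cexp (ln r, y) - z0) with (Cexp (ln r, y)) by ring.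
    rewrite Cmod_Cexp. apply exp_ln. exact Hr. }
  assert (HB : (Cmod (CRInt (fun y => (f z0 - K (ln r', y))%C) 0 (2 * PI)) <= (2 * PI - 0) * e)%R).
  { apply CRInt_le; [lra| |].
    - exact (ex_RInt_minus (V := C_R_NormedModule) (fun _ : R => f z0) (fun y => K (ln r', y))
        0 (2 * PI) (ex_RInt_const _ _ _) (ex_CRInt_vline K _ HKc _ _)).
    - intros y _. left.
      replace (f z0 - K (ln r', y)) with (- (K (ln r', y) - f z0)) by ring. rewrite Cmod_opp.
      unfold K. apply Hd.
      replace (z0 + Cexp (ln r', y) - z0) with (Cexp (ln r', y)) by ring.
      rewrite Cmod_Cexp. simpl. rewrite exp_ln; lra. }
  assert (EB : CRInt (fun y => f z0 - K (ln r', y)) 0 (2 * PI) = RtoC (2 * PI) * f z0 - B).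
  { transitivity (CRInt (fun _ => f z0) 0 (2 * PI) - B).
    - exact (RInt_minus (V := C_R_CompleteNormedModule) (fun _ : R => f z0) (fun y => K (ln r', y))
        0 (2 * PI) (ex_RInt_const _ _ _) (ex_CRInt_vline K _ HKc _ _)).
    - f_equal. rewrite RInt_const, scal_R_Cmult. f_equal. f_equal. ring. }
  assert (Hfin : (2 * PI * Cmod (f z0) <= 2 * PI * (M + e))%R).
  { rewrite <- (Rabs_pos_eq (2 * PI)) at 1 by lra. rewrite <- Cmod_R, <- Cmod_mult.
    replace (RtoC (2 * PI) * f z0) with ((RtoC (2 * PI) * f z0 - B) + A) by (rewrite EAB; ring).
    eapply Rle_trans; [apply Cmod_triangle|]. rewrite <- EB. lra. }
  apply Rmult_le_reg_l in Hfin; lra.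
Qed.

(** * Propagation of smallness *)

(** A polynomial equal to 1 at 0, whose modulus on the unit circle is less than 1
    outside an arc around 1 that is shorter than a half circle.  To first order in
    the small factor, |tilt|^2 - 1 is proportional to 2 x^2 + 2 x - 1 where
    x = Re u, which is negative for -1 <= x <= 1/6; 1/18 is so small
    that the second-order term does not change the sign. *)
Definition tilt (u : C) : C := 1 + (2 * u + u * u) * RtoC (/ 18).

Lemma Cmod_tilt_lt_1 (u : C) : Cmod u = 1%R -> (Re u <= 1 / 6)%R -> (Cmod (tilt u) <= 72 / 73)%R.
Proof.
  intros Hu Hre. apply Rsqr_incr_0_var; [|lra]. rewrite !Rsqr_pow2.
  pose proof (Cmod2_alt u) as E. rewrite Hu in E.
  rewrite Cmod2_alt. destruct u as [x y]. unfold tilt, Re, Im in *; simpl in *.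
  assert (Hy : (y * y = 1 - x * x)%R) by lra.
  assert (Hx : (-1 <= x)%R) by nra.
  match goal with |- (?a * (?a * 1) + ?b * (?b * 1) <= _)%R =>
    replace (a * (a * 1) + b * (b * 1))%R with
     ((1 + (2 * x + x * x - y * y) / 18) ^ 2 + (y * y) * ((2 + 2 * x) / 18) ^ 2)%R by field end.
  assert (Hp : (0 <= (x + 1) * (1 / 6 - x))%R) by (apply Rmult_le_pos; lra).
  apply Rle_trans with (1 + (4 * x + 4 * (x * x) - 2) / 18 + (5 + 4 * x) / 324)%R; [right|nra].
  transitivity (1 + (2 * x + x * x - y * y) / 9 + ((2 * x + x * x - y * y) ^ 2 + y * y * (2 + 2 * x) ^ 2) / 324)%R;
    [field|].
  rewrite Hy. field.
Qed.

Lemma Cmod_tilt_le (u : C) : Cmod u = 1%R -> (Cmod (tilt u) <= 7 / 6)%R.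
Proof.
  intros Hu. unfold tilt.
  eapply Rle_trans; [apply Cmod_triangle|]. rewrite Cmod_1, Cmod_mult, Cmod_R, Rabs_pos_eq by lra.
  assert (Cmod (2 * u + u * u) <= 3)%R; [|lra].
  eapply Rle_trans; [apply Cmod_triangle|]. rewrite !Cmod_mult, Hu, Cmod_R, Rabs_pos_eq by lra. lra.
Qed.

Lemma entire_pow f n : entire f -> entire (fun z => f z ^ n).
Proof.
  intros Hf. induction n as [|n IH]; intros z; simpl; [apply cdiff_const|].
  apply cdiff_mult; auto.
Qed.

(** If f is tiny on the lower arc, it is small at the centre even though the lower
    arc is less than half of the circle: multiplying f by a power of [tilt],
    turned so that its peak points downward, damps the other arc. *)
Lemma Cmod_center_le_two_arcs (f : C -> C) (z0 : C) (M eta : R) (n : nat) :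
  entire f ->
  (forall z, Cmod (z - z0) = 3%R -> (Cmod (f z) <= M)%R) ->
  (forall z, Cmod (z - z0) = 3%R -> (Im z <= Im z0 - 1 / 2)%R -> (Cmod (f z) <= eta)%R) ->
  (Cmod (f z0) <= Rmax (M * (72 / 73) ^ n) (eta * (7 / 6) ^ n))%R.
Proof.
  intros Hf HM Heta.
  (* u maps the circle of radius 3 to the unit circle and the lowest point to 1 *)
  pose (u := fun z => (z - z0) * (Ci * RtoC (/ 3))).
  assert (Hu0 : tilt (u z0) = 1) by (unfold tilt, u; ring).
  replace (f z0) with (f z0 * tilt (u z0) ^ n) by (rewrite Hu0, Cpow_1_l; ring).
  apply (Cmod_center_le_circle (fun z => f z * tilt (u z) ^ n) z0 3); [|lra|].
  - intros z. apply cdiff_mult; [apply Hf|].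
    apply (entire_pow (fun z => tilt (u z))). intros w.
    apply (cdiff_comp tilt u).
    + unfold tilt. apply cdiff_plus; [apply cdiff_const|].
      apply cdiff_mult; [|apply cdiff_const].
      apply cdiff_plus; apply cdiff_mult; try apply cdiff_id; apply cdiff_const.
    + apply cdiff_mult; [|apply cdiff_const]. apply cdiff_plus; [apply cdiff_id|apply cdiff_const].
  - intros z Hz.
    assert (Hu : Cmod (u z) = 1%R).
    { unfold u. rewrite !Cmod_mult, Hz, Cmod_Ci, Cmod_R, Rabs_pos_eq by lra. field. }
    rewrite Cmod_mult, Cmod_pow.
    pose proof (Cmod_ge_0 (f z)). pose proof (Cmod_ge_0 (tilt (u z))).
    destruct (Rle_dec (Im z) (Im z0 - 1 / 2)) as [Hi|Hi].
    + eapply Rle_trans; [|apply Rmax_r].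
      apply Rmult_le_compat; auto using pow_le. apply pow_incr. split; auto. now apply Cmod_tilt_le.
    + eapply Rle_trans; [|apply Rmax_l].
      apply Rmult_le_compat; auto using pow_le. apply pow_incr. split; auto. apply Cmod_tilt_lt_1; auto.
      unfold u. destruct z, z0. simpl in *. lra.
Qed.

(** Each step raises the height of the strip of convergence by 1/2.  For a centre
    z at most 1/2 above the strip, the circle of radius 3 around z stays in the
    rectangle of uniform boundedness, and its points at least 1/2 below z lie in
    the previous strip, hence [Cmod_center_le_two_arcs] applies: first choose the
    exponent to damp M, then the rank to make the other term small.  Five steps
    lead from height 3/2 to height 4, beyond pi; each costs 3 in width on either side. *)
Lemma vanishing_propagates (F : nat -> C -> C) (X M : R) :
  (forall n, entire (F n)) ->
  (forall n z, (Rabs (Re z) <= X)%R -> (Rabs (Im z) <= 10)%R -> (Cmod (F n z) <= M)%R) ->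
  (forall eta, (0 < eta)%R -> exists N, forall n z, (N <= n)%nat ->
     (Rabs (Re z) <= X)%R -> (Rabs (Im z) <= 3 / 2)%R -> (Cmod (F n z) <= eta)%R) ->
  forall z, (Rabs (Re z) <= X - 15)%R -> (0 <= Im z <= 4)%R ->
  forall eta, (0 < eta)%R -> exists N, forall n, (N <= n)%nat -> (Cmod (F n z) <= eta)%R.
Proof.
  intros HF HM Hstart.
  assert (Hind : forall j, (j <= 5)%nat -> forall eta, (0 < eta)%R -> exists N, forall n z, (N <= n)%nat ->
     (Rabs (Re z) <= X - 3 * INR j)%R -> (- (3 / 2) <= Im z <= 3 / 2 + INR j / 2)%R ->
     (Cmod (F n z) <= eta)%R).
  { induction j as [|j IH]; intros Hj eta Heta.
    - destruct (Hstart eta Heta) as [N HN]. exists N. intros n z Hn Hx Hy. simpl in *.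
      apply HN; auto; [lra|]. apply Rabs_le; lra.
    - assert (Hj4 : (INR j <= 4)%R) by (replace 4%R with (INR 4) by (simpl; ring); apply le_INR; lia).
      pose proof (pos_INR j) as Hj0.
      destruct (pow_lt_1_zero (72 / 73) ltac:(rewrite Rabs_pos_eq; lra) (eta / (Rabs M + 1))
        ltac:(pose proof (Rabs_pos M); apply Rdiv_lt_0_compat; lra)) as [L HL].
      specialize (HL L (Nat.le_refl L)).
      assert (Hp : (0 < (72 / 73) ^ L)%R) by (apply pow_lt; lra).
      assert (Hq : (0 < (7 / 6) ^ L)%R) by (apply pow_lt; lra).
      rewrite Rabs_pos_eq in HL by lra.
      destruct (IH ltac:(lia) (eta / (7 / 6) ^ L)%R ltac:(apply Rdiv_lt_0_compat; lra)) as [N HN].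
      destruct (IH ltac:(lia) eta Heta) as [N' HN'].
      exists (Nat.max N N'). intros n z Hn Hx Hy. rewrite S_INR in Hx, Hy.
      destruct (Rle_dec (Im z) (3 / 2 + INR j / 2)) as [Hlow|Hhigh].
      + apply HN'; [lia|lra|lra].
      + assert (Hcirc : forall w, Cmod (w - z) = 3%R ->
          (Rabs (Re w) <= X - 3 * INR j)%R /\ (Im z - 3 <= Im w <= Im z + 3)%R).
        { intros w Hw. pose proof (re_le_Cmod (w - z)) as H1. pose proof (Im_le_Cmod (w - z)) as H2.
          rewrite Hw in H1, H2. apply Rabs_le_between in H1, H2, Hx.
          destruct w, z. simpl in *. split; [apply Rabs_le|]; lra. }
        eapply Rle_trans.
        { apply (Cmod_center_le_two_arcs (F n) z M (eta / (7 / 6) ^ L) L (HF n)).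
          - intros w Hw. destruct (Hcirc w Hw) as [H1 H2]. apply HM; [lra|]. apply Rabs_le. lra.
          - intros w Hw Hi. destruct (Hcirc w Hw) as [H1 H2]. apply HN; [lia|lra|lra]. }
        apply Rmax_lub.
        * pose proof (Rle_abs M). pose proof (Rabs_pos M).
          apply Rmult_lt_compat_r with (r := (Rabs M + 1)%R) in HL; [|lra].
          unfold Rdiv in HL at 2. rewrite Rmult_assoc, Rinv_l in HL by lra. nra.
        * right. field. lra. }
  intros z Hx Hy eta Heta.
  destruct (Hind 5%nat ltac:(lia) eta Heta) as [N HN]. exists N. intros n Hn.
  simpl in HN. apply HN; [exact Hn|lra|lra].
Qed.

(** * Summation by parts with periodic coefficients *)

(** A constant of codomain C, so that [ring] and rewriting see complex numbers and
    not elements of an abstract monoid. *)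
Definition csum (f : nat -> C) (a b : nat) : C := sum_n_m (G := C_AbelianMonoid) f a b.

Lemma cDelta_S c k b n :
  cDelta c (S k) b n = csum (fun i => acoef c i * cDelta c k b (n + i)%nat) 1 c.
Proof. reflexivity. Qed.

Lemma csum_empty (f : nat -> C) a b : (b < a)%nat -> csum f a b = 0.
Proof. intros H. exact (sum_n_m_zero (G := C_AbelianMonoid) f a b H). Qed.

Lemma csum_last (f : nat -> C) a b : (a <= S b)%nat -> csum f a (S b) = csum f a b + f (S b).
Proof. intros H. exact (sum_n_Sm (G := C_AbelianMonoid) f a b H). Qed.

Lemma csum_first (f : nat -> C) a b : (a <= b)%nat -> csum f a b = f a + csum f (S a) b.
Proof. intros H. exact (sum_Sn_m (G := C_AbelianMonoid) f a b H). Qed.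

Lemma csum_shift (f : nat -> C) a b : csum (fun n => f (S n)) a b = csum f (S a) (S b).
Proof. exact (sum_n_m_S (G := C_AbelianMonoid) f a b). Qed.

Lemma csum_ext (f g : nat -> C) a b : (forall n, (a <= n <= b)%nat -> f n = g n) ->
  csum f a b = csum g a b.
Proof. exact (sum_n_m_ext_loc (G := C_AbelianMonoid) f g a b). Qed.

Lemma csum_plus (f g : nat -> C) a b : csum (fun n => f n + g n) a b = csum f a b + csum g a b.
Proof. exact (sum_n_m_plus (G := C_AbelianMonoid) f g a b). Qed.

Lemma csum_scal (k : C) (f : nat -> C) a b : csum (fun n => k * f n) a b = k * csum f a b.
Proof. exact (sum_n_m_mult_l (K := C_Ring) k f a b). Qed.

Lemma csum_const_1 a b : (a <= S b)%nat -> csum (fun _ => RtoC 1) a b = NtoC (S b - a).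
Proof.
  intros H. unfold NtoC. induction b as [|b IH].
  - destruct a as [|[|a]]; [..|lia].
    + rewrite csum_first, csum_empty by lia. simpl. ring.
    + rewrite csum_empty by lia. reflexivity.
  - destruct (Nat.eq_dec a (S (S b))) as [->|Ha].
    + rewrite csum_empty by lia. rewrite Nat.sub_diag. reflexivity.
    + rewrite csum_last, IH by lia. rewrite <- RtoC_plus. f_equal.
      replace (S (S b) - a)%nat with (S (S b - a)) by lia. rewrite S_INR. ring.
Qed.

Lemma Cmod_csum_le (f : nat -> C) (B : R) a b : (0 <= B)%R -> (a <= S b)%nat ->
  (forall n, (a <= n <= b)%nat -> (Cmod (f n) <= B)%R) ->
  (Cmod (csum f a b) <= INR (S b - a) * B)%R.
Proof.
  intros HB Hab Hf. induction b as [|b IH].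
  - destruct a as [|[|a]]; [..|lia].
    + rewrite csum_first, csum_empty, Cplus_0_r by lia. simpl. specialize (Hf 0%nat ltac:(lia)). lra.
    + rewrite csum_empty, Cmod_0 by lia. simpl. lra.
  - destruct (Nat.eq_dec a (S (S b))) as [->|Ha].
    + rewrite csum_empty, Cmod_0, Nat.sub_diag by lia. simpl. lra.
    + rewrite csum_last by lia. eapply Rle_trans; [apply Cmod_triangle|].
      replace (S (S b) - a)%nat with (S (S b - a)) by lia. rewrite S_INR, Rmult_plus_distr_r.
      specialize (IH ltac:(lia) ltac:(intros; apply Hf; lia)).
      specialize (Hf (S b) ltac:(lia)). lra.
Qed.

Lemma cdiff_csum (f : C -> nat -> C) z a b :
  (forall n, (a <= n <= b)%nat -> cdiff (fun s => f s n) z) -> cdiff (fun s => csum (f s) a b) z.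
Proof.
  intros H. induction b as [|b IH].
  - destruct a as [|a].
    + apply (cdiff_ext (fun s => f s O)); [|apply H; lia].
      intros w. rewrite csum_first, csum_empty by lia. ring.
    + apply (cdiff_ext (fun _ => 0)); [|apply cdiff_const]. intros w. now rewrite csum_empty by lia.
  - destruct (le_gt_dec a (S b)) as [Ha|Ha].
    + apply (cdiff_ext (fun s => csum (f s) a b + f s (S b))).
      { intros w. now rewrite csum_last by lia. }
      apply cdiff_plus; [apply IH; intros; apply H; lia|apply H; lia].
    + apply (cdiff_ext (fun _ => 0)); [|apply cdiff_const]. intros w. now rewrite csum_empty by lia.
Qed.

Lemma acoef_small c i : (0 < i < c)%nat -> acoef c i = 1.
Proof.
  intros H. unfold acoef. rewrite Nat.mod_small by lia.
  destruct i; [lia|reflexivity].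
Qed.

Lemma acoef_mult c q : (0 < c)%nat -> acoef c (c * q) = 1 - NtoC c.
Proof. intros H. unfold acoef. rewrite Nat.mul_comm, Nat.Div0.mod_mul. reflexivity. Qed.

Lemma acoef_self c : (0 < c)%nat -> acoef c c = 1 - NtoC c.
Proof. intros H. rewrite <- (Nat.mul_1_r c) at 2. now apply acoef_mult. Qed.

Lemma acoef_period c n : acoef c (n + c) = acoef c n.
Proof. unfold acoef. replace (n + c)%nat with (n + 1 * c)%nat by lia. now rewrite Nat.Div0.mod_add. Qed.

Lemma Cmod_acoef_le c n : (1 <= c)%nat -> (Cmod (acoef c n) <= INR c)%R.
Proof.
  intros H. apply le_INR in H. simpl in H. unfold acoef, NtoC. destruct (_ =? _)%nat.
  - rewrite <- RtoC_minus, Cmod_R, Rabs_left1; lra.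
  - rewrite Cmod_1. lra.
Qed.

Lemma acoef_sum_backwards c p : (1 <= c)%nat -> csum (fun i => acoef c (p + c - i)) 1 c = 0.
Proof.
  intros Hc. induction p as [|p IH].
  - destruct c as [|c]; [lia|]. rewrite csum_last by lia.
    rewrite (csum_ext _ (fun _ => RtoC 1)).
    2:{ intros n Hn. apply acoef_small. lia. }
    rewrite csum_const_1 by lia.
    replace (0 + S c - S c)%nat with (S c * 0)%nat by lia. rewrite acoef_mult by lia.
    replace (S c - 1)%nat with c by lia. unfold NtoC. rewrite S_INR, RtoC_plus. ring.
  - destruct c as [|c]; [lia|]. rewrite <- csum_shift.
    rewrite csum_first by lia.
    rewrite csum_last in IH by lia.
    replace (S p + S c - 1)%nat with (p + S c)%nat by lia. rewrite acoef_period.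
    rewrite <- IH.
    replace (p + S c - S c)%nat with p by lia.
    rewrite (csum_ext (fun n => acoef (S c) (S p + S c - S n)) (fun i => acoef (S c) (p + S c - i)))
      by (intros; f_equal; lia).
    ring.
Qed.

Lemma acoef_sum c : (1 <= c)%nat -> csum (acoef c) 1 c = 0.
Proof.
  intros Hc. destruct c as [|c]; [lia|]. rewrite csum_last by lia.
  rewrite (csum_ext _ (fun _ => RtoC 1)).
  2:{ intros n Hn. apply acoef_small. lia. }
  rewrite csum_const_1, acoef_self by lia.
  replace (S c - 1)%nat with c by lia. unfold NtoC. rewrite S_INR, RtoC_plus. ring.
Qed.

(** Over one period a_i is 1 except for a_c = 1 - c, so the convolution is the sum
    of a over a period, which is 0, minus c a_p. *)
Lemma acoef_convolution c p : (1 <= c)%nat ->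
  csum (fun i => acoef c i * acoef c (p + c - i)) 1 c = - NtoC c * acoef c p.
Proof.
  intros Hc. pose proof (acoef_sum_backwards c p Hc) as H.
  destruct c as [|c]; [lia|]. rewrite csum_last in H |- * by lia.
  rewrite acoef_self by lia. replace (p + S c - S c)%nat with p in * by lia.
  rewrite (csum_ext _ (fun i => acoef (S c) (p + S c - i))).
  2:{ intros n Hn. rewrite acoef_small by lia. ring. }
  replace (csum _ 1 c) with (- acoef (S c) p) by (rewrite <- (Cplus_0_r (- _)), <- H; ring).
  ring.
Qed.

Definition twisted_sum (c N : nat) (b : nat -> C) : C := csum (fun n => acoef c n * b n) 1 N.

Definition head (c : nat) (b : nat -> C) : C :=
  csum (fun i => NtoC (c + i) * b (i + 1)%nat) 0 (c - 2) - (NtoC c - 1) ^ 2 * b c.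

(** The coefficient of b_(N+l) in the boundary terms of the summation by parts at
    N.  The index is shifted by one period c to keep the subtraction nonnegative. *)
Definition edge_coef (c N l : nat) : C := csum (fun i => acoef c i * acoef c (N + c + l - i)) l c.
Definition edge (c N : nat) (b : nat -> C) : C := csum (fun l => edge_coef c N l * b (N + l)%nat) 1 c.

(** For N = 0 the identity of [summation_by_parts] reads 0 = head + edge: this is
    where the weights c + i and -(c-1)^2 come from. *)
Lemma edge_0 c b : (2 <= c)%nat -> head c b + edge c 0 b = 0.
Proof.
  intros Hc. unfold head, edge. destruct c as [|[|d]]; try lia.
  replace (S (S d) - 2)%nat with d by lia.
  rewrite csum_last by lia. rewrite <- csum_shift.
  rewrite (csum_ext (fun n => edge_coef (S (S d)) 0 (S n) * b (0 + S n)%nat)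
    (fun i => (- (1)) * (NtoC (S (S d) + i) * b (i + 1)%nat))).
  - rewrite csum_scal. unfold edge_coef at 1.
    rewrite (csum_first _ (S (S d))), (csum_empty _ (S (S (S d)))) by lia.
    replace (0 + S (S d) + S (S d) - S (S d))%nat with (S (S d)) by lia.
    rewrite acoef_self by lia. simpl (0 + _)%nat. ring.
  - intros n Hn. simpl (0 + S n)%nat. rewrite Nat.add_1_r.
    replace (edge_coef (S (S d)) 0 (S n)) with (- NtoC (S (S d) + n)); [ring|].
    unfold edge_coef. rewrite csum_last, csum_first by lia.
    rewrite (csum_ext _ (fun _ => RtoC 1)).
    2:{ intros i Hi. rewrite !acoef_small by lia. ring. }
    rewrite csum_const_1 by lia.
    replace (0 + S (S d) + S n - S n)%nat with (S (S d)) by lia.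
    replace (0 + S (S d) + S n - S (S d))%nat with (S n) by lia.
    rewrite acoef_self, (acoef_small (S (S d)) (S n)) by lia.
    replace (S (S d) - S (S n))%nat with (d - n)%nat by lia.
    unfold NtoC. rewrite minus_INR, plus_INR, !S_INR, !RtoC_plus, RtoC_minus by lia. ring.
Qed.

Lemma edge_step c N b : (1 <= c)%nat ->
  edge c (S N) b = edge c N b + NtoC c * (acoef c (S N) * b (S N))
    + acoef c (S N) * cDelta c 1 b (S N).
Proof.
  intros Hc. unfold edge at 2.
  (* drop l = 1, whose coefficient is a full convolution, and add the empty l = c + 1 *)
  assert (E : csum (fun l => edge_coef c N l * b (N + l)%nat) 1 c =
    - NtoC c * (acoef c (S N) * b (S N)) +
    csum (fun l => edge_coef c N (S l) * b (S N + l)%nat) 1 c).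
  { rewrite csum_first by lia.
    replace (edge_coef c N 1) with (- NtoC c * acoef c (S N)).
    2:{ rewrite <- acoef_convolution by exact Hc. unfold edge_coef. apply csum_ext.
        intros n Hn. do 2 f_equal. lia. }
    rewrite (csum_ext (fun l => edge_coef c N (S l) * b (S N + l)%nat)
      (fun l => edge_coef c N (S l) * b (N + S l)%nat)) by (intros; do 2 f_equal; lia).
    rewrite (csum_shift (fun l => edge_coef c N l * b (N + l)%nat)), (csum_last _ 2) by lia.
    replace (edge_coef c N (S c)) with (RtoC 0) by (unfold edge_coef; now rewrite csum_empty by lia).
    rewrite Nat.add_1_r. ring. }
  rewrite E. unfold edge. rewrite cDelta_S. simpl cDelta.
  rewrite (csum_ext (fun l => edge_coef c (S N) l * b (S N + l)%nat)
    (fun l => edge_coef c N (S l) * b (S N + l)%nat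
       + acoef c (S N) * (acoef c l * b (S (N + l))))).
  - rewrite csum_plus, csum_scal. ring.
  - intros l Hl. unfold edge_coef. rewrite csum_first by lia.
    replace (S N + c + l - l)%nat with (S N + c)%nat by lia. rewrite acoef_period.
    rewrite (csum_ext (fun i => acoef c i * acoef c (S N + c + l - i))
      (fun i => acoef c i * acoef c (N + c + S l - i))) by (intros; do 2 f_equal; lia).
    simpl (S N + l)%nat. ring.
Qed.

Lemma summation_by_parts c N b : (2 <= c)%nat ->
  NtoC c * twisted_sum c N b + twisted_sum c N (cDelta c 1 b) = head c b + edge c N b.
Proof.
  intros Hc. unfold twisted_sum. induction N as [|N IH].
  - rewrite edge_0, !csum_empty by lia. ring.
  - rewrite !csum_last, edge_step by lia.
    rewrite !Cplus_assoc, <- IH. ring.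
Qed.

Definition euler_weight (c j : nat) : C := (- (1)) ^ j / NtoC c ^ (j + 1).

Lemma NtoC_neq_0 n : (1 <= n)%nat -> NtoC n <> 0.
Proof. intros H E. apply RtoC_inj in E. apply le_INR in H. simpl in H. lra. Qed.

(** The exact transform of the twisted sum up to N after K + 1 summations by parts,
    with the edge terms, which tend to 0, left out. *)
Definition approx (c K N : nat) (b : nat -> C) : C :=
  csum (fun j => euler_weight c j * head c (cDelta c j b)) 0 K
  - euler_weight c K * twisted_sum c N (cDelta c (S K) b).

Lemma twisted_sum_transform c K N b : (2 <= c)%nat ->
  twisted_sum c N b = approx c K N b + csum (fun j => euler_weight c j * edge c N (cDelta c j b)) 0 K.
Proof.
  intros Hc. pose proof (NtoC_neq_0 c ltac:(lia)) as H0. unfold approx.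
  assert (Hstep : forall j, twisted_sum c N (cDelta c (S j) b) =
     head c (cDelta c j b) + edge c N (cDelta c j b) - NtoC c * twisted_sum c N (cDelta c j b)).
  { intros j. rewrite <- summation_by_parts by exact Hc.
    change (cDelta c 1 (cDelta c j b)) with (cDelta c (S j) b). ring. }
  induction K as [|K IH].
  - rewrite !(csum_first _ 0 0), !csum_empty, Hstep by lia.
    change (cDelta c 0 b) with b.
    unfold euler_weight. simpl Cpow. field. exact H0.
  - rewrite IH, !csum_last, (Hstep (S K)) by lia.
    replace (euler_weight c K) with (- NtoC c * euler_weight c (S K)).
    2:{ unfold euler_weight. simpl. field. split; [now apply Cpow_nz|exact H0]. }
    ring.
Qed.

Lemma cDelta_ext c k b b' n : (forall i, (n <= i)%nat -> b i = b' i) -> cDelta c k b n = cDelta c k b' n.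
Proof.
  revert n. induction k as [|k IH]; intros n H; [apply H; lia|].
  rewrite !cDelta_S.   apply csum_ext. intros i _. f_equal. apply IH. intros; apply H; lia.
Qed.

Lemma cDelta_bound c k b n (B : R) : (1 <= c)%nat -> (0 <= B)%R ->
  (forall i, (n <= i)%nat -> (Cmod (b i) <= B)%R) ->
  (Cmod (cDelta c k b n) <= (INR c * INR c) ^ k * B)%R.
Proof.
  intros Hc HB. revert n. induction k as [|k IH]; intros n H; [simpl|rewrite cDelta_S].
  - specialize (H n (Nat.le_refl n)). lra.
  - assert (H1 := le_INR _ _ Hc). simpl in H1.
    assert (Hp : (0 <= (INR c * INR c) ^ k * B)%R) by (apply Rmult_le_pos; [apply pow_le; nra|exact HB]).
    eapply Rle_trans.
    + apply Cmod_csum_le with (B := (INR c * ((INR c * INR c) ^ k * B))%R); [nra|lia|].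
      intros i _. rewrite Cmod_mult.
      apply Rmult_le_compat; auto using Cmod_ge_0. { now apply Cmod_acoef_le. }
      apply IH. intros; apply H; lia.
    + replace (S c - 1)%nat with c by lia. simpl. right. ring.
Qed.

Lemma Cmod_edge_le c N b (B : R) : (1 <= c)%nat -> (0 <= B)%R ->
  (forall i, (N < i)%nat -> (Cmod (b i) <= B)%R) ->
  (Cmod (edge c N b) <= INR c ^ 4 * B)%R.
Proof.
  intros Hc HB H. assert (H1 := le_INR _ _ Hc). simpl in H1.
  assert (He : forall l, (1 <= l <= c)%nat -> (Cmod (edge_coef c N l) <= INR c ^ 3)%R).
  { intros l Hl. eapply Rle_trans.
    - apply Cmod_csum_le with (B := (INR c * INR c)%R); [nra|lia|]. intros i _. rewrite Cmod_mult.
      apply Rmult_le_compat; auto using Cmod_ge_0, Cmod_acoef_le.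
    - assert (Hle : (INR (S c - l) <= INR c)%R) by (apply le_INR; lia).
      replace (INR c ^ 3)%R with (INR c * (INR c * INR c))%R by ring. apply Rmult_le_compat_r; nra. }
  assert (Hp : (0 <= INR c ^ 3)%R) by (apply pow_le; lra).
  eapply Rle_trans.
  - apply Cmod_csum_le with (B := (INR c ^ 3 * B)%R); [nra|lia|]. intros l Hl. rewrite Cmod_mult.
    apply Rmult_le_compat; auto using Cmod_ge_0. apply H. lia.
  - replace (S c - 1)%nat with c by lia. simpl. right. ring.
Qed.

Lemma Cmod_euler_weight_le c j : (1 <= c)%nat -> (Cmod (euler_weight c j) <= 1)%R.
Proof.
  intros Hc. unfold euler_weight. assert (H1 := le_INR _ _ Hc). simpl in H1.
  rewrite Cmod_div, !Cmod_pow, Cmod_m1, pow1 by (apply Cpow_nz, NtoC_neq_0; exact Hc).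
  unfold NtoC. rewrite Cmod_R, Rabs_pos_eq by lra.
  assert (H : (1 <= INR c ^ (j + 1))%R) by now apply pow_R1_Rle.
  apply Rmult_le_reg_r with (INR c ^ (j + 1))%R; [lra|].
  unfold Rdiv. rewrite Rmult_assoc, Rinv_l; lra.
Qed.

Lemma cdiff_cDelta c k (b : C -> nat -> C) z n :
  (forall i, cdiff (fun s => b s i) z) -> cdiff (fun s => cDelta c k (b s) n) z.
Proof.
  intros H. revert n. induction k as [|k IH]; intros n; simpl; [apply H|].
  apply (cdiff_csum (fun s i => acoef c i * cDelta c k (b s) (n + i)%nat)). intros i _.
  apply cdiff_mult; [apply cdiff_const|apply IH].
Qed.

Lemma cdiff_approx c K N (b : C -> nat -> C) z :
  (forall i, cdiff (fun s => b s i) z) -> cdiff (fun s => approx c K N (b s)) z.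
Proof.
  intros H. pose proof (fun k n => cdiff_cDelta c k b z n H) as HD. unfold approx, head, twisted_sum.
  apply cdiff_minus.
  - apply (cdiff_csum (fun s j => euler_weight c j * 
      (csum (fun i => NtoC (c + i) * cDelta c j (b s) (i + 1)%nat) 0 (c - 2)
      - (NtoC c - 1) ^ 2 * cDelta c j (b s) c))). intros j _.
    apply cdiff_mult; [apply cdiff_const|]. apply cdiff_minus.
    + apply (cdiff_csum (fun s i => NtoC (c + i) * cDelta c j (b s) (i + 1)%nat)). intros i _.
      apply cdiff_mult; [apply cdiff_const|apply HD].
    + apply cdiff_mult; [apply cdiff_const|apply HD].
  - apply cdiff_mult; [apply cdiff_const|].
    apply (cdiff_csum (fun s n => acoef c n * cDelta c (S K) (b s) n)). intros n _.
    apply cdiff_mult; [apply cdiff_const|apply HD].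
Qed.

(** * Decay of the iterated differences of powers *)

(** Derivatives of complex functions of a real variable are taken by components, so
    that the real mean value theorem applies to them. *)
Definition is_curve_deriv (f : R -> C) (x : R) (l : C) : Prop :=
  is_derive (fun t => Re (f t)) x (Re l) /\ is_derive (fun t => Im (f t)) x (Im l).

Lemma is_curve_deriv_plus f g x l m :
  is_curve_deriv f x l -> is_curve_deriv g x m -> is_curve_deriv (fun t => f t + g t) x (l + m).
Proof.
  intros [Hf Hf'] [Hg Hg']. split.
  - exact (is_derive_plus (K := R_AbsRing) (V := R_NormedModule) _ _ _ _ _ Hf Hg).
  - exact (is_derive_plus (K := R_AbsRing) (V := R_NormedModule) _ _ _ _ _ Hf' Hg').
Qed.

Lemma is_curve_deriv_scal k f x l :
  is_curve_deriv f x l -> is_curve_deriv (fun t => k * f t) x (k * l).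
Proof.
  intros [Hf Hf']. split; simpl.
  - exact (is_derive_minus (K := R_AbsRing) (V := R_NormedModule) _ _ _ _ _
      (is_derive_scal _ _ (Re k) _ Hf) (is_derive_scal _ _ (Im k) _ Hf')).
  - exact (is_derive_plus (K := R_AbsRing) (V := R_NormedModule) _ _ _ _ _
      (is_derive_scal _ _ (Re k) _ Hf') (is_derive_scal _ _ (Im k) _ Hf)).
Qed.

Lemma is_curve_deriv_shift f x a l :
  is_curve_deriv f (x + a)%R l -> is_curve_deriv (fun t => f (t + a)%R) x l.
Proof.
  assert (H : forall g : R -> R, forall m, is_derive g (x + a)%R m -> is_derive (fun t => g (t + a)%R) x m).
  { intros g m Hg. rewrite <- (Rmult_1_l m).
    apply (is_derive_comp (K := R_AbsRing) (V := R_NormedModule) g (fun t => t + a)%R); [exact Hg|].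
    auto_derive; trivial. }
  intros [Hf Hf']. split; [exact (H (fun t => Re (f t)) _ Hf)|exact (H (fun t => Im (f t)) _ Hf')].
Qed.

Lemma is_curve_deriv_csum (f : nat -> R -> C) x (l : nat -> C) n :
  (forall i, is_curve_deriv (f i) x (l i)) ->
  is_curve_deriv (fun t => csum (fun i => f i t) 1 n) x (csum l 1 n).
Proof.
  intros H. induction n as [|n IH].
  - rewrite csum_empty by lia. split.
    + apply (is_derive_ext (fun _ => 0%R)); [intros t; now rewrite csum_empty by lia|].
      exact (is_derive_const (K := R_AbsRing) (V := R_NormedModule) 0%R x).
    + apply (is_derive_ext (fun _ => 0%R)); [intros t; now rewrite csum_empty by lia|].
      exact (is_derive_const (K := R_AbsRing) (V := R_NormedModule) 0%R x).
  - rewrite csum_last by lia.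
    destruct (is_curve_deriv_plus _ _ _ _ _ IH (H (S n))) as [H1 H2].
    split; (eapply is_derive_ext; [|eassumption]);
      intros t; cbv beta; now rewrite csum_last by lia.
Qed.

Lemma curve_mean_value (f f' : R -> C) (x y D : R) : (x <= y)%R ->
  (forall t, (x <= t <= y)%R -> is_curve_deriv f t (f' t)) ->
  (forall t, (x <= t <= y)%R -> (Cmod (f' t) <= D)%R) ->
  (Cmod (f y - f x) <= 2 * D * (y - x))%R.
Proof.
  intros Hxy Hd HD.
  assert (Hreal : forall g g' : R -> R, (forall t, (x <= t <= y)%R -> is_derive g t (g' t)) ->
    (forall t, (x <= t <= y)%R -> (Rabs (g' t) <= D)%R) -> (Rabs (g y - g x) <= D * (y - x))%R).
  { intros g g' Hg HgD.
    destruct (MVT_gen g x y g') as [t [Ht E]]; rewrite ?Rmin_left, ?Rmax_right in * by lra.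
    - intros t Ht. apply Hg. lra.
    - intros t Ht. apply continuity_pt_filterlim.
      apply (ex_derive_continuous (K := R_AbsRing) (V := R_NormedModule)). exists (g' t). apply Hg. lra.
    - rewrite E, Rabs_mult, (Rabs_pos_eq (y - x)) by lra.
      apply Rmult_le_compat_r; [lra|]. apply HgD. lra. }
  eapply Rle_trans; [apply Cmod_le_Re_Im|].
  assert (H1 := Hreal (fun t => Re (f t)) (fun t => Re (f' t)) ltac:(intros; now apply Hd)
    ltac:(intros; eapply Rle_trans; [apply re_le_Cmod|now apply HD])).
  assert (H2 := Hreal (fun t => Im (f t)) (fun t => Im (f' t)) ltac:(intros; now apply Hd)
    ltac:(intros; eapply Rle_trans; [apply Im_le_Cmod|now apply HD])).
  unfold Rminus, Re, Im in *. simpl in *. lra.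
Qed.

Definition npower (s : C) (x : R) : C := Cexp (- s * RtoC (ln x)).

Lemma Cmod_npower s x : Cmod (npower s x) = exp (- Re s * ln x).
Proof. unfold npower. rewrite Cmod_Cexp. f_equal. destruct s. simpl. ring. Qed.

Lemma is_curve_deriv_npower s x : (0 < x)%R ->
  is_curve_deriv (npower s) x (- s * npower (s + 1) x).
Proof.
  intros Hx.
  assert (E : npower (s + 1) x = RtoC (/ x) * npower s x).
  { unfold npower. replace (- (s + 1) * RtoC (ln x)) with (RtoC (- ln x) + - s * RtoC (ln x))
      by (rewrite RtoC_opp; ring).
    rewrite Cexp_plus, Cexp_RtoC, exp_Ropp, exp_ln by lra. reflexivity. }
  rewrite E. destruct s as [a b]. unfold npower, Cexp, is_curve_deriv, Re, Im. simpl. split.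
  - auto_derive; [lra|]. unfold Rminus. field. lra.
  - auto_derive; [lra|]. unfold Rminus. field. lra.
Qed.

(** The operator of [cDelta] on functions of a real variable, where derivatives are
    available. *)
Fixpoint rDelta (c k : nat) (f : R -> C) (x : R) : C :=
  match k with
  | O => f x
  | S k' => csum (fun i => acoef c i * rDelta c k' f (x + INR i)%R) 1 c
  end.

Lemma cDelta_rDelta c k f n : cDelta c k (fun i => f (INR i)) n = rDelta c k f (INR n).
Proof.
  revert n. induction k as [|k IH]; intros n; [reflexivity|].
  rewrite cDelta_S. simpl. apply csum_ext. intros i _. rewrite IH, plus_INR. reflexivity.
Qed.

Lemma is_curve_deriv_rDelta c k s x : (0 < x)%R ->
  is_curve_deriv (rDelta c k (npower s)) x (- s * rDelta c k (npower (s + 1)) x).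
Proof.
  revert x. induction k as [|k IH]; intros x Hx; [now apply is_curve_deriv_npower|].
  simpl. rewrite <- csum_scal.
  rewrite (csum_ext _ (fun i => acoef c i * (- s * rDelta c k (npower (s + 1)) (x + INR i))))
    by (intros; ring).
  apply (is_curve_deriv_csum (fun i t => acoef c i * rDelta c k (npower s) (t + INR i)%R)).
  intros i. apply is_curve_deriv_scal.
  apply (is_curve_deriv_shift (rDelta c k (npower s))). apply IH.
  pose proof (pos_INR i). lra.
Qed.

(** Unfolds to A^k |s (s+1) ... (s+k-1)|; the recursion through s + 1 is that of
    the derivative of x^(-s). *)
Fixpoint decay_const (A : R) (k : nat) (s : C) : R :=
  match k with
  | O => 1
  | S k' => A * Cmod s * decay_const A k' (s + 1)
  end.

Lemma decay_const_pos A k s : (0 <= A)%R -> (0 <= decay_const A k s)%R.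
Proof.
  intros HA. revert s. induction k as [|k IH]; intros s; simpl; [lra|].
  apply Rmult_le_pos; [apply Rmult_le_pos|]; auto using Cmod_ge_0.
Qed.

Lemma decay_const_le A k : (0 <= A)%R -> forall rho, exists B, forall s,
  (Cmod s <= rho)%R -> (decay_const A k s <= B)%R.
Proof.
  intros HA. induction k as [|k IH]; intros rho; simpl; [exists 1%R; intros; lra|].
  destruct (IH (rho + 1)%R) as [B HB]. exists (A * rho * B)%R. intros s Hs.
  pose proof (Cmod_ge_0 s). apply Rmult_le_compat.
  - now apply Rmult_le_pos.
  - now apply decay_const_pos.
  - now apply Rmult_le_compat_l.
  - apply HB. eapply Rle_trans; [apply Cmod_triangle|]. rewrite Cmod_1. lra.
Qed.

Lemma decay_const_neg_nat A m k : (m < k)%nat -> decay_const A k (- NtoC m) = 0%R.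
Proof.
  revert k. induction m as [|m IH]; intros k Hk; (destruct k as [|k]; [lia|]); simpl.
  - unfold NtoC; simpl. rewrite Cmod_opp, Cmod_0. ring.
  - replace (- NtoC (S m) + 1) with (- NtoC m).
    + rewrite IH by lia. ring.
    + unfold NtoC. rewrite S_INR, RtoC_plus. ring.
Qed.

(** Since the coefficients a_i sum to 0, Delta g (x) is a combination of increments
    g(x+i) - g(x), which the mean value inequality bounds by the derivative of g; for
    g = Delta^k x^(-s) this derivative is -s Delta^k x^(-s-1), to which induction
    applies.  Nonnegativity of Re s + k makes the bound nonincreasing in x. *)
Lemma rDelta_decay c k : (1 <= c)%nat -> forall s x, (0 < x)%R -> (0 <= Re s + INR k)%R ->
  (Cmod (rDelta c k (npower s) x) <=
   decay_const (2 * INR c ^ 3) k s * exp (- (Re s + INR k) * ln x))%R.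
Proof.
  intros Hc. assert (H1 := le_INR _ _ Hc). simpl in H1.
  assert (HA : (0 <= 2 * INR c ^ 3)%R) by (pose proof (pow_le (INR c) 3); lra).
  induction k as [|k IH]; intros s x Hx Hs.
  - simpl. rewrite Cmod_npower, Rplus_0_r. lra.
  - rewrite S_INR in *. simpl rDelta.
    change (decay_const (2 * INR c ^ 3) (S k) s) with
      (2 * INR c ^ 3 * Cmod s * decay_const (2 * INR c ^ 3) k (s + 1))%R.
    set (D := (Cmod s * decay_const (2 * INR c ^ 3) k (s + 1) * exp (- (Re s + (INR k + 1)) * ln x))%R).
    assert (HD : (0 <= D)%R).
    { apply Rmult_le_pos; [|left; apply exp_pos].
      apply Rmult_le_pos; [apply Cmod_ge_0|now apply decay_const_pos]. }
    (* the coefficients sum to zero, so each term may be replaced by an increment *)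
    replace (csum (fun i => acoef c i * rDelta c k (npower s) (x + INR i)) 1 c) with
      (csum (fun i => acoef c i * (rDelta c k (npower s) (x + INR i) - rDelta c k (npower s) x)) 1 c).
    2:{ rewrite (csum_ext _ (fun i => acoef c i * rDelta c k (npower s) (x + INR i)
          + (- rDelta c k (npower s) x) * acoef c i)) by (intros; ring).
        rewrite csum_plus, csum_scal, acoef_sum by exact Hc. ring. }
    eapply Rle_trans.
    { apply Cmod_csum_le with (B := (INR c * (2 * D * INR c))%R); [nra|lia|].
      intros i Hi. rewrite Cmod_mult.
      apply Rmult_le_compat; auto using Cmod_ge_0, Cmod_acoef_le.
      assert (Hi' : (0 <= INR i <= INR c)%R) by (split; [apply pos_INR|apply le_INR; lia]).
      eapply Rle_trans.
      { apply (curve_mean_value (rDelta c k (npower s))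
          (fun t => - s * rDelta c k (npower (s + 1)) t) x (x + INR i) D); [lra| |].
        - intros t Ht. apply is_curve_deriv_rDelta. lra.
        - intros t Ht. rewrite Cmod_mult, Cmod_opp. unfold D. rewrite Rmult_assoc.
          apply Rmult_le_compat_l; [apply Cmod_ge_0|].
          eapply Rle_trans; [apply IH; [lra|]|].
          + unfold Re in *; destruct s; simpl in *; lra.
          + apply Rmult_le_compat_l; [now apply decay_const_pos|].
            replace (Re (s + 1) + INR k)%R with (Re s + (INR k + 1))%R by (unfold Re; destruct s; simpl; ring).
            assert (Hl : (ln x <= ln t)%R) by (apply ln_le; lra).
            destruct (Req_dec (- (Re s + (INR k + 1)) * ln t) (- (Re s + (INR k + 1)) * ln x)) as [->|Hne]; [lra|].
            left. apply exp_increasing. nra. }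
      replace (x + INR i - x)%R with (INR i) by ring.
      apply Rmult_le_compat_l; lra. }
    replace (S c - 1)%nat with c by lia. unfold D. right. ring.
Qed.

Lemma cDelta_decay c k s n : (1 <= c)%nat -> (1 <= n)%nat -> (0 <= Re s + INR k)%R ->
  (Cmod (cDelta c k (fun i => npower s (INR i)) n) <=
   decay_const (2 * INR c ^ 3) k s * exp (- (Re s + INR k) * ln (INR n)))%R.
Proof.
  intros Hc Hn Hs. rewrite cDelta_rDelta. apply rDelta_decay; auto.
  apply lt_0_INR. lia.
Qed.

Lemma cDelta_neg_nat c k m n : (1 <= c)%nat -> (1 <= n)%nat -> (m < k)%nat ->
  cDelta c k (fun i => npower (- NtoC m) (INR i)) n = 0.
Proof.
  intros Hc Hn Hk. apply Cmod_eq_0, Rle_antisym; [|apply Cmod_ge_0].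
  eapply Rle_trans; [apply cDelta_decay; auto|].
  - unfold NtoC; simpl. apply lt_INR in Hk. lra.
  - rewrite decay_const_neg_nat by exact Hk. lra.
Qed.

Lemma npower_neg_nat m n : (1 <= n)%nat -> npower (- NtoC m) (INR n) = Npow_seq m n.
Proof.
  intros Hn. assert (Hp : (0 < INR n)%R) by (apply lt_0_INR; lia).
  unfold npower, Npow_seq, NtoC.
  replace (- - RtoC (INR m) * RtoC (ln (INR n))) with (RtoC (INR m * ln (INR n)))
    by (rewrite RtoC_mult; ring).
  rewrite <- RtoC_pow.
  rewrite Cexp_RtoC. f_equal. rewrite <- Rpower_pow by exact Hp. reflexivity.
Qed.

Lemma twisted_sum_bounded c N (b : nat -> C) (B : R) : (1 <= c)%nat -> (0 <= B)%R ->
  (forall n, (1 <= n)%nat -> (Cmod (b n) <= B * exp (- 2 * ln (INR n)))%R) ->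
  (Cmod (twisted_sum c N b) <= 2 * (INR c * B))%R.
Proof.
  intros Hc HB Hb. assert (H1 := le_INR _ _ Hc). simpl in H1.
  assert (HcB : (0 <= INR c * B)%R) by nra.
  unfold twisted_sum.
  assert (Hterm : forall n, (1 <= n)%nat ->
    (Cmod (acoef c n * b n) <= INR c * B * (/ INR n * / INR n))%R).
  { intros n Hn. assert (Hp : (0 < INR n)%R) by (apply lt_0_INR; lia).
    rewrite Cmod_mult, Rmult_assoc.
    apply Rmult_le_compat; auto using Cmod_ge_0, Cmod_acoef_le.
    eapply Rle_trans; [now apply Hb|]. right. f_equal.
    replace (- 2 * ln (INR n))%R with (- ln (INR n) + - ln (INR n))%R by ring.
    rewrite exp_plus, exp_Ropp, exp_ln by exact Hp. reflexivity. }
  destruct N as [|N]; [rewrite csum_empty, Cmod_0 by lia; lra|].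
  (* the sum of 1/n^2 up to n = N is at most 2 - 1/N *)
  assert (Hstrong : (Cmod (csum (fun n => acoef c n * b n)%C 1 (S N))
    <= INR c * B * (2 - / INR (S N)))%R).
  { induction N as [|N IH].
    - rewrite csum_last, csum_empty, Cplus_0_l by lia.
      eapply Rle_trans; [now apply Hterm|]. simpl. lra.
    - rewrite csum_last by lia. eapply Rle_trans; [apply Cmod_triangle|].
      specialize (Hterm (S (S N)) ltac:(lia)).
      assert (Hq : (0 < INR (S N))%R) by (apply lt_0_INR; lia).
      rewrite (S_INR (S N)) in *. set (q := INR (S N)) in *.
      assert (Hk : (/ (q + 1) * / (q + 1) <= / q - / (q + 1))%R).
      { replace (/ q - / (q + 1))%R with (/ q * / (q + 1))%R by (field; lra).
        apply Rmult_le_compat_r; [left; apply Rinv_0_lt_compat; lra|].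
        apply Rinv_le_contravar; lra. }
      nra. }
  assert (0 < / INR (S N))%R by (apply Rinv_0_lt_compat, lt_0_INR; lia). nra.
Qed.

(** * Zeta and the values at the negative integers *)

Lemma Cminus_eq_0 (a b : C) : a - b = 0 -> a = b.
Proof. intros H. replace a with ((a - b) + b) by ring. rewrite H. ring. Qed.

Definition dirichlet_sum (N : nat) (s : C) : C := csum (fun n => npower s (INR n)) 1 N.

Lemma is_series_dirichlet_sum s z :
  is_series (K := C_AbsRing) (V := C_NormedModule) (fun n : nat => Npowc (S n) (- s)) z ->
  forall eta, (0 < eta)%R -> exists N0, forall N, (N0 <= N)%nat ->
    (Cmod (dirichlet_sum N s - z) <= eta)%R.
Proof.
  intros H eta Heta.
  destruct (proj1 (filterlim_locally (U := C_UniformSpace) _ _) H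
    (mkposreal (eta / 2) ltac:(lra))) as [N0 HN0].
  exists (S N0). intros N HN. destruct N as [|N]; [lia|].
  specialize (HN0 N ltac:(lia)).
  apply C_NormedModule_mixin_compat2 in HN0. simpl in HN0.
  replace (dirichlet_sum (S N) s) with
    (sum_n (G := C_AbelianMonoid) (fun n : nat => Npowc (S n) (- s)) N : C).
  - assert (sqrt 2 <= 2)%R.
    { rewrite <- (sqrt_Rsqr 2) at 2 by lra. apply sqrt_le_1_alt. unfold Rsqr. lra. }
    left. eapply Rlt_le_trans; [exact HN0|]. nra.
  - unfold dirichlet_sum. rewrite <- csum_shift. reflexivity.
Qed.

Lemma Cmod_npower_le s sigma n : (1 <= n)%nat -> (sigma <= Re s)%R ->
  (Cmod (npower s (INR n)) <= exp (- sigma * ln (INR n)))%R.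
Proof.
  intros Hn Hs. rewrite Cmod_npower.
  assert (Hl : (0 <= ln (INR n))%R).
  { rewrite <- ln_1. apply le_INR in Hn. apply ln_le; simpl in *; lra. }
  destruct (Req_dec (- Re s * ln (INR n)) (- sigma * ln (INR n))) as [->|Hne]; [lra|].
  left. apply exp_increasing. nra.
Qed.

(** The terms are dominated by those of the real exponent sigma, which are
    nonnegative reals; this makes the convergence of the Dirichlet series uniform
    on Re s >= sigma. *)
Lemma dirichlet_sum_dominated s (sigma : R) N P : (sigma <= Re s)%R -> (N <= P)%nat ->
  (Cmod (dirichlet_sum P s - dirichlet_sum N s) <=
   Re (dirichlet_sum P sigma - dirichlet_sum N sigma))%R.
Proof.
  intros Hs HP. induction P as [|P IH].
  - replace N with 0%nat by lia. unfold Cminus. rewrite !Cplus_opp_r, Cmod_0. simpl. lra.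
  - destruct (Nat.eq_dec N (S P)) as [->|HN].
    + unfold Cminus. rewrite !Cplus_opp_r, Cmod_0. simpl. lra.
    + specialize (IH ltac:(lia)). unfold dirichlet_sum in *. rewrite !(csum_last _ 1 P) by lia.
      set (d := csum _ 1 P - csum _ 1 N) in IH.
      match type of IH with (_ <= Re (?u - ?v))%R => set (U := u) in *; set (V := v) in * end.
      match goal with |- (Cmod (?u + ?x - ?v) <= _)%R =>
        replace (u + x - v) with (d + x) by (unfold d; ring) end.
      eapply Rle_trans; [apply Cmod_triangle|].
      pose proof (Cmod_npower_le s sigma (S P) ltac:(lia) Hs) as Hn.
      assert (E : Re (npower sigma (INR (S P))) = exp (- sigma * ln (INR (S P)))).
      { unfold npower. rewrite <- RtoC_opp, <- RtoC_mult, Cexp_RtoC. reflexivity. }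
      unfold Re in *. simpl fst in *. lra.
Qed.

Lemma zeta_uniform_limit zeta sigma : is_riemann_zeta zeta -> (1 < sigma)%R ->
  forall eta, (0 < eta)%R -> exists N0, forall N s, (N0 <= N)%nat -> (sigma <= Re s)%R ->
    (Cmod (zeta s - dirichlet_sum N s) <= eta)%R.
Proof.
  intros [Hz _] Hsig eta Heta.
  destruct (is_series_dirichlet_sum _ _ (Hz (RtoC sigma) Hsig) (eta / 2) ltac:(lra)) as [N0 HN0].
  exists N0. intros N s HN Hs.
  apply le_epsilon. intros e He.
  destruct (is_series_dirichlet_sum _ _ (Hz s ltac:(lra)) e He) as [N1 HN1].
  set (P := Nat.max N N1). specialize (HN1 P ltac:(lia)).
  pose proof (dirichlet_sum_dominated s sigma N P Hs ltac:(lia)) as Hd.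
  pose proof (HN0 N HN) as A1. pose proof (HN0 P ltac:(lia)) as A2.
  set (zs := zeta (RtoC sigma)) in *.
  assert (Hc : (Re (dirichlet_sum P sigma - dirichlet_sum N sigma) <= eta)%R).
  { eapply Rle_trans; [apply Rle_abs|]. eapply Rle_trans; [apply re_le_Cmod|].
    replace (dirichlet_sum P sigma - dirichlet_sum N sigma) with
      ((dirichlet_sum P sigma - zs) + - (dirichlet_sum N sigma - zs)) by ring.
    eapply Rle_trans; [apply Cmod_triangle|]. rewrite Cmod_opp. lra. }
  replace (zeta s - dirichlet_sum N s) with
    (- (dirichlet_sum P s - zeta s) + (dirichlet_sum P s - dirichlet_sum N s)) by ring.
  eapply Rle_trans; [apply Cmod_triangle|]. rewrite Cmod_opp. lra.
Qed.

Lemma csum_cat (f : nat -> C) p q : csum f 1 (p + q) = csum f 1 p + csum (fun i => f (p + i)%nat) 1 q.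
Proof.
  induction q as [|q IH].
  - rewrite (csum_empty _ 1 0), Nat.add_0_r by lia. ring.
  - rewrite Nat.add_succ_r, !csum_last, IH, Nat.add_succ_r by lia. ring.
Qed.

Lemma npower_mult s x y : (0 < x)%R -> (0 < y)%R -> npower s (x * y) = npower s x * npower s y.
Proof.
  intros Hx Hy. unfold npower. rewrite ln_mult, RtoC_plus, <- Cexp_plus by assumption. f_equal. ring.
Qed.

Lemma Npowc_1_minus c s : (1 <= c)%nat -> Npowc c (1 - s) = NtoC c * npower s (INR c).
Proof.
  intros Hc. unfold Npowc, npower, NtoC.
  replace ((1 - s) * RtoC (ln (INR c))) with (RtoC (ln (INR c)) + - s * RtoC (ln (INR c))) by ring.
  rewrite Cexp_plus, Cexp_RtoC, exp_ln; [reflexivity|]. apply lt_0_INR. lia.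
Qed.

(** The coefficient a_n differs from 1 by -c at the multiples of c only.  At a
    multiple of c as upper limit the twisted sum is therefore an exact combination
    of two partial sums of the Dirichlet series. *)
Lemma twisted_sum_dirichlet c N s : (1 <= c)%nat ->
  twisted_sum c (c * N) (fun n => npower s (INR n)) =
  dirichlet_sum (c * N) s - Npowc c (1 - s) * dirichlet_sum N s.
Proof.
  intros Hc. unfold twisted_sum, dirichlet_sum. induction N as [|N IH].
  - rewrite Nat.mul_0_r, !csum_empty by lia. ring.
  - replace (c * S N)%nat with (c * N + c)%nat by lia.
    rewrite !csum_cat, IH, (csum_last _ 1 N) by lia.
    rewrite Npowc_1_minus, (csum_ext (fun i => acoef c (c * N + i) * npower s (INR (c * N + i)))
      (fun i => acoef c i * npower s (INR (c * N + i)))).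
    2:{ intros i _. f_equal. unfold acoef.
        replace (c * N + i)%nat with (i + N * c)%nat by lia. now rewrite Nat.Div0.mod_add. }
    2: exact Hc.
    destruct c as [|d]; [lia|].
    rewrite !(csum_last _ 1 d), acoef_self by lia.
    rewrite (csum_ext (fun i => acoef (S d) i * npower s (INR (S d * N + i)))
      (fun i => npower s (INR (S d * N + i)))).
    2:{ intros i Hi. rewrite acoef_small by lia. ring. }
    replace (S d * N + S d)%nat with (S d * S N)%nat by lia.
    rewrite (mult_INR (S d) (S N)), npower_mult by (apply lt_0_INR; lia). ring.
Qed.

Lemma cdiff_npower x z : cdiff (fun s => npower s x) z.
Proof.
  apply (cdiff_comp Cexp (fun s => - s * RtoC (ln x))); [apply entire_Cexp|].
  apply (cdiff_ext (fun s => - RtoC (ln x) * s)); [intros; ring|].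
  apply cdiff_mult; [apply cdiff_const|apply cdiff_id].
Qed.

Lemma cdiff_zeta_sub zeta c (s : C) : is_riemann_zeta zeta -> s <> 1 -> cdiff (zeta_sub zeta c) s.
Proof.
  intros [_ Hz] Hs. unfold zeta_sub. apply cdiff_mult; [|now apply Hz].
  apply cdiff_minus; [apply cdiff_const|].
  apply (cdiff_comp Cexp (fun s : C => (1 - s) * RtoC (ln (INR c)))); [apply entire_Cexp|].
  apply cdiff_mult; [|apply cdiff_const].
  apply cdiff_minus; [apply cdiff_const|apply cdiff_id].
Qed.

(** The error is the tail of the Dirichlet series plus the edge terms, which are
    O(1/N) as they only involve n^(-s) with n > c N and Re s > 1. *)
Lemma zeta_sub_approx_uniform zeta c K sigma : is_riemann_zeta zeta -> (2 <= c)%nat -> (1 < sigma)%R ->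
  forall eta, (0 < eta)%R -> exists N0, forall N s, (N0 <= N)%nat -> (sigma <= Re s)%R ->
    (Cmod (zeta_sub zeta c s - approx c K (c * N) (fun n => npower s (INR n))) <= eta)%R.
Proof.
  intros Hz Hc Hsig eta Heta. assert (Hc1 := le_INR _ _ Hc). simpl in Hc1.
  set (A := (INR (S K) * (INR c ^ 4 * (INR c * INR c) ^ K))%R).
  assert (HcK : (0 < INR c ^ 4 * (INR c * INR c) ^ K)%R)
    by (apply Rmult_lt_0_compat; apply pow_lt; nra).
  assert (HK : (0 < INR (S K))%R) by (apply lt_0_INR; lia).
  assert (HA : (0 < A)%R) by (apply Rmult_lt_0_compat; assumption).
  destruct (zeta_uniform_limit zeta sigma Hz Hsig (eta / (2 * (1 + INR c)))
    ltac:(apply Rdiv_lt_0_compat; lra)) as [N0 HN0].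
  destruct (INR_unbounded (2 * A / eta)) as [N1 HN1].
  exists (S (Nat.max N0 N1)). intros N s HN Hs.
  set (b := fun n => npower s (INR n)).
  assert (HNN : (N <= c * N)%nat) by nia.
  pose proof (twisted_sum_transform c K (c * N) b Hc) as HT.
  unfold b in HT at 1. rewrite twisted_sum_dirichlet in HT by lia.
  replace (zeta_sub zeta c s - approx c K (c * N) b) with
    (((zeta s - dirichlet_sum (c * N) s) + - (Npowc c (1 - s) * (zeta s - dirichlet_sum N s)))
     + csum (fun j => euler_weight c j * edge c (c * N) (cDelta c j b)) 0 K).
  2:{ replace (csum _ 0 K) with (dirichlet_sum (c * N) s - Npowc c (1 - s) * dirichlet_sum N s
        - approx c K (c * N) b) by (rewrite HT; ring). unfold zeta_sub. ring. }
  eapply Rle_trans; [apply Cmod_triangle|].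
  eapply Rle_trans; [apply Rplus_le_compat_r, Cmod_triangle|].
  rewrite Cmod_opp, Cmod_mult.
  pose proof (HN0 (c * N)%nat s ltac:(lia) Hs) as B1.
  pose proof (HN0 N s ltac:(lia) Hs) as B2.
  assert (B3 : (Cmod (Npowc c (1 - s)) <= INR c)%R).
  { rewrite Npowc_1_minus by lia. rewrite Cmod_mult. unfold NtoC. rewrite Cmod_R, Rabs_pos_eq by lra.
    rewrite <- (Rmult_1_r (INR c)) at 3. apply Rmult_le_compat_l; [lra|].
    eapply Rle_trans; [apply (Cmod_npower_le s 0); [lia|lra]|].
    rewrite Ropp_0, Rmult_0_l, exp_0. lra. }
  assert (HNp : (0 < INR N)%R) by (apply lt_0_INR; lia).
  assert (Hinv : (0 < / INR N)%R) by now apply Rinv_0_lt_compat.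
  assert (B4 : (Cmod (csum (fun j => euler_weight c j * edge c (c * N) (cDelta c j b))%C 0 K)
     <= A * / INR N)%R).
  { eapply Rle_trans.
    - apply Cmod_csum_le with (B := (INR c ^ 4 * (INR c * INR c) ^ K * / INR N)%R); [nra|lia|].
      intros j Hj. rewrite Cmod_mult.
      assert (Hpow : ((INR c * INR c) ^ j <= (INR c * INR c) ^ K)%R) by (apply Rle_pow; [nra|lia]).
      assert (Hpj : (0 <= (INR c * INR c) ^ j)%R) by (apply pow_le; nra).
      assert (Hed : (Cmod (edge c (c * N) (cDelta c j b)) <= INR c ^ 4 * ((INR c * INR c) ^ j * / INR N))%R).
      { apply Cmod_edge_le; [lia|nra|]. intros i Hi.
        apply cDelta_bound; [lia|lra|]. intros l Hl.
        eapply Rle_trans; [apply (Cmod_npower_le s 1); [lia|lra]|].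
        assert (HlN : (INR N <= INR l)%R) by (apply le_INR; lia).
        replace (- (1) * ln (INR l))%R with (- ln (INR l))%R by ring.
        rewrite exp_Ropp, exp_ln by lra. apply Rinv_le_contravar; lra. }
      pose proof (Cmod_euler_weight_le c j ltac:(lia)).
      pose proof (Cmod_ge_0 (edge c (c * N) (cDelta c j b))).
      pose proof (Cmod_ge_0 (euler_weight c j)).
      assert (Hc4 : (0 <= INR c ^ 4)%R) by (apply pow_le; lra).
      apply Rle_trans with (INR c ^ 4 * ((INR c * INR c) ^ j * / INR N))%R; [nra|].
      rewrite Rmult_assoc. apply Rmult_le_compat_l; [exact Hc4|].
      apply Rmult_le_compat_r; lra.
    - rewrite Nat.sub_0_r. unfold A. right. ring. }
  assert (B5 : (A * / INR N <= eta / 2)%R).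
  { assert (Hle : (INR N1 <= INR N)%R) by (apply le_INR; lia).
    apply Rmult_le_reg_r with (INR N); [exact HNp|]. rewrite Rmult_assoc, Rinv_l by lra.
    apply Rmult_le_reg_r with (2 / eta)%R; [apply Rdiv_lt_0_compat; lra|].
    replace (eta / 2 * INR N * (2 / eta))%R with (INR N) by (field; lra).
    replace (A * 1 * (2 / eta))%R with (2 * A / eta)%R by (field; lra). lra. }
  assert (B6 : ((1 + INR c) * (eta / (2 * (1 + INR c))) = eta / 2)%R) by (field; lra).
  set (q := (eta / (2 * (1 + INR c)))%R) in *.
  pose proof (Cmod_ge_0 (zeta s - dirichlet_sum N s)).
  pose proof (Cmod_ge_0 (Npowc c (1 - s))).
  assert (Cmod (Npowc c (1 - s)) * Cmod (zeta s - dirichlet_sum N s) <= INR c * q)%R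
    by (apply Rmult_le_compat; lra).
  lra.
Qed.

(** At s = -m all differences of order greater than m vanish, among them the one in
    the remaining twisted sum: nothing depends on N any more. *)
Lemma approx_neg_nat c m K N : (2 <= c)%nat -> (m <= K)%nat ->
  approx c K N (fun n => npower (- NtoC m) (INR n)) =
  csum (fun j => euler_weight c j * head c (cDelta c j (Npow_seq m))) 0 m.
Proof.
  intros Hc HK. unfold approx.
  replace (twisted_sum _ _ _) with (RtoC 0).
  2:{ unfold twisted_sum. symmetry. rewrite (csum_ext _ (fun n => 0 * acoef c n)).
      - rewrite csum_scal. ring.
      - intros n Hn. rewrite cDelta_neg_nat by lia. ring. }
  rewrite Cmult_0_r. unfold Cminus. rewrite Copp_0, Cplus_0_r.
  assert (Hhead : forall j, head c (cDelta c j (fun n => npower (- NtoC m) (INR n))) =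
     head c (cDelta c j (Npow_seq m))).
  { intros j. assert (E : forall n, (1 <= n)%nat ->
      cDelta c j (fun n => npower (- NtoC m) (INR n)) n = cDelta c j (Npow_seq m) n).
    { intros n Hn. apply cDelta_ext. intros i Hi. apply npower_neg_nat. lia. }
    unfold head. rewrite E by lia. f_equal.
    apply csum_ext. intros i _. now rewrite E by lia. }
  induction K as [|K IH].
  - assert (m = 0%nat) as -> by lia. apply csum_ext. intros j _. now rewrite Hhead.
  - destruct (Nat.eq_dec m (S K)) as [->|Hne].
    + apply csum_ext. intros j _. now rewrite Hhead.
    + assert (H0 : head c (cDelta c (S K) (fun n => npower (- NtoC m) (INR n))) = 0).
      { unfold head. rewrite cDelta_neg_nat, (csum_ext _ (fun i => 0 * NtoC (c + i))) by
          (try (intros i _; rewrite cDelta_neg_nat by lia; ring); lia).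
        rewrite csum_scal. ring. }
      rewrite csum_last, IH, H0 by lia. ring.
Qed.

(** The substitution s = 1 + e^w removes the point s = 1, where nothing is known of
    zeta, and turns the half-plane Re s > 1 into horizontal strips. *)
Lemma zeta_sub_neg_nat zeta c m : is_riemann_zeta zeta -> (2 <= c)%nat ->
  zeta_sub zeta c (- NtoC m) =
  csum (fun j => euler_weight c j * head c (cDelta c j (Npow_seq m))) 0 m.
Proof.
  intros Hz Hc.
  (* 15 is the width lost by vanishing_propagates on each side *)
  set (X := (ln (INR (S m)) + 15)%R).
  assert (Hl : (0 <= ln (INR (S m)))%R).
  { rewrite <- ln_1. apply ln_le; [lra|]. rewrite S_INR. pose proof (pos_INR m). lra. }
  (* Re s >= 1 - exp X on the rectangle |Re w| <= X, so that Re s + K + 1 >= 2 and the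
     remaining sum is dominated by the sum of 1/n^2 *)
  destruct (INR_unbounded (1 + exp X)) as [K1 HK1].
  set (K := Nat.max K1 m).
  set (s_of := fun w => 1 + Cexp w).
  pose (F := fun N w => zeta_sub zeta c (s_of w)
     - approx c K (c * N) (fun n => npower (s_of w) (INR n))).
  assert (Hne : forall w, s_of w <> 1).
  { intros w E. pose proof (Cmod_Cexp w) as Hm. pose proof (exp_pos (Re w)).
    replace (Cexp w) with (s_of w - 1) in Hm by (unfold s_of; ring).
    rewrite E in Hm. unfold Cminus in Hm. rewrite Cplus_opp_r, Cmod_0 in Hm. lra. }
  assert (Hs : forall w, cdiff s_of w).
  { intros w. apply cdiff_plus; [apply cdiff_const|apply entire_Cexp]. }
  assert (Hzs : forall w, cdiff (fun w => zeta_sub zeta c (s_of w)) w).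
  { intros w. apply (cdiff_comp (zeta_sub zeta c) s_of); [now apply cdiff_zeta_sub|apply Hs]. }
  assert (Hap : forall N w, cdiff (fun w => approx c K N (fun n => npower (s_of w) (INR n))) w).
  { intros N w. apply (cdiff_comp (fun s => approx c K N (fun n => npower s (INR n))) s_of); [|apply Hs].
    apply (cdiff_approx c K N (fun s n => npower s (INR n))). intros i. apply cdiff_npower. }
  assert (HF : forall N, entire (F N)).
  { intros N w. apply cdiff_minus; [apply Hzs|apply Hap]. }
  assert (HRe : forall w, (Rabs (Re w) <= X)%R -> (exp (- X) <= exp (Re w) <= exp X)%R).
  { intros w Hw. apply Rabs_le_between in Hw. split.
    - destruct (Req_dec (- X) (Re w)) as [->|]; [lra|left; apply exp_increasing; lra].
    - destruct (Req_dec (Re w) X) as [->|]; [lra|left; apply exp_increasing; lra]. }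
  assert (HA : (0 <= 2 * INR c ^ 3)%R) by (pose proof (pow_le (INR c) 3 (pos_INR c)); lra).
  destruct (decay_const_le (2 * INR c ^ 3) (S K) HA (1 + exp X)) as [B HB].
  assert (HX : (- X <= X)%R) by (unfold X; lra).
  destruct (Ccont_bounded (F 0%nat) (- X) X (- 10) 10 (entire_Ccont _ (HF 0%nat)) HX ltac:(lra)) as [M0 HM0].
  assert (HM : forall N w, (Rabs (Re w) <= X)%R -> (Rabs (Im w) <= 10)%R ->
    (Cmod (F N w) <= M0 + 2 * (INR c * B))%R).
  { intros N w Hx Hy. pose proof (HRe w Hx) as [_ He].
    specialize (HM0 w). apply Rabs_le_between in Hx, Hy. specialize (HM0 Hx Hy).
    set (b := fun n => npower (s_of w) (INR n)).
    replace (F N w) with (F 0%nat w + euler_weight c K * twisted_sum c (c * N) (cDelta c (S K) b)).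
    2:{ unfold F, approx. fold b. rewrite Nat.mul_0_r.
        replace (twisted_sum c 0 _) with (RtoC 0) by (symmetry; apply csum_empty; lia). ring. }
    eapply Rle_trans; [apply Cmod_triangle|]. apply Rplus_le_compat; [exact HM0|].
    assert (Hsw : (Cmod (s_of w) <= 1 + exp X)%R).
    { unfold s_of. eapply Rle_trans; [apply Cmod_triangle|]. rewrite Cmod_1, Cmod_Cexp. lra. }
    pose proof (HB _ Hsw) as HBw.
    pose proof (decay_const_pos _ (S K) (s_of w) HA) as HB0.
    assert (HReS : (2 <= Re (s_of w) + INR (S K))%R).
    { assert (HKK : (INR K1 <= INR K)%R) by (apply le_INR; lia). rewrite S_INR.
      pose proof (re_le_Cmod (Cexp w)) as Hr. rewrite Cmod_Cexp in Hr.
      apply Rabs_le_between in Hr.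
      replace (Re (s_of w)) with (1 + Re (Cexp w))%R by reflexivity. lra. }
    rewrite Cmod_mult. rewrite <- (Rmult_1_l (2 * _)).
    apply Rmult_le_compat; auto using Cmod_ge_0. { apply Cmod_euler_weight_le; lia. }
    apply twisted_sum_bounded; [lia|lra|]. intros n Hn.
    eapply Rle_trans; [apply cDelta_decay; [lia|exact Hn|lra]|].
    apply Rmult_le_compat; [exact HB0|left; apply exp_pos|exact HBw|].
    assert (Hln : (0 <= ln (INR n))%R).
    { rewrite <- ln_1. apply le_INR in Hn. apply ln_le; simpl in *; lra. }
    destruct (Req_dec (- (Re (s_of w) + INR (S K)) * ln (INR n)) (- 2 * ln (INR n))) as [->|]; [lra|].
    left. apply exp_increasing. nra. }
  assert (Hcos : (0 < cos (3 / 2))%R) by (apply cos_gt_0; pose proof PI2_3_2; lra).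
  assert (Hstart : forall eta, (0 < eta)%R -> exists N0, forall N w, (N0 <= N)%nat ->
     (Rabs (Re w) <= X)%R -> (Rabs (Im w) <= 3 / 2)%R -> (Cmod (F N w) <= eta)%R).
  { intros eta Heta.
    (* 3/2 < pi/2, so Re s = 1 + Re (e^w) is bounded away from 1 here *)
    assert (Hsig : (1 < 1 + exp (- X) * cos (3 / 2))%R)
      by (pose proof (Rmult_lt_0_compat _ _ (exp_pos (- X)) Hcos); lra).
    destruct (zeta_sub_approx_uniform zeta c K _ Hz Hc Hsig eta Heta) as [N0 HN0].
    exists N0. intros N w HN Hx Hy. apply HN0; [exact HN|].
    destruct (HRe w Hx) as [He _].
    replace (Re (s_of w)) with (1 + exp (Re w) * cos (Im w))%R by reflexivity.
    apply Rplus_le_compat_l.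
    apply Rmult_le_compat; [left; apply exp_pos|lra|exact He|].
    replace (cos (Im w)) with (cos (Rabs (Im w))).
    - pose proof PI2_3_2. pose proof (Rabs_pos (Im w)). apply cos_decr_1; lra.
    - destruct (Rle_dec 0 (Im w)); [now rewrite Rabs_pos_eq|].
      rewrite Rabs_left1 by lra. apply cos_neg. }
  (* 1 + e^w0 = 1 - (m + 1) *)
  set (w0 := (ln (INR (S m)), PI) : C).
  assert (Hw0 : s_of w0 = - NtoC m).
  { unfold s_of, w0, Cexp, NtoC, Re, Im, fst, snd.
    rewrite cos_PI, sin_PI, exp_ln by (apply lt_0_INR; lia). rewrite S_INR.
    apply injective_projections; simpl; ring. }
  assert (Hconst : forall N, F N w0 = zeta_sub zeta c (- NtoC m)
     - csum (fun j => euler_weight c j * head c (cDelta c j (Npow_seq m))) 0 m).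
  { intros N. unfold F. rewrite Hw0, (approx_neg_nat c m K) by (assumption || lia). reflexivity. }
  assert (Hlim := vanishing_propagates F X (M0 + 2 * (INR c * B)) HF HM Hstart w0
    ltac:(unfold X, w0, Re, fst; rewrite Rabs_pos_eq; lra)
    ltac:(unfold w0, Im, snd; pose proof PI_4; pose proof PI_RGT_0; pose proof PI2_3_2; lra)).
  apply Cminus_eq_0.
  apply Cmod_eq_0, Rle_antisym; [|apply Cmod_ge_0].
  apply le_epsilon. intros e He. destruct (Hlim e He) as [N0 HN0].
  specialize (HN0 N0 (Nat.le_refl N0)). rewrite Hconst in HN0. lra.
Qed.

Theorem corollary6 (zeta : C -> C) (Hzeta : is_riemann_zeta zeta)
    (c : nat) (hc : (2 <= c)%nat) (m : nat) :
  zeta (- NtoC m) = / (1 - NtoC c ^ (m + 1)) * zeta_sub zeta c (- NtoC m) /\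
  / (1 - NtoC c ^ (m + 1)) * zeta_sub zeta c (- NtoC m) =
    1 / (1 - NtoC c ^ (m + 1)) *
    sum_n_m (G := C_AbelianMonoid)
      (fun j : nat =>
         (- (1)) ^ j / NtoC c ^ (j + 1) *
         (sum_n_m (G := C_AbelianMonoid)
            (fun i : nat => NtoC (c + i) * cDelta c j (Npow_seq m) (i + 1)%nat)
            0 (c - 2)
          - (NtoC c - 1) ^ 2 * cDelta c j (Npow_seq m) c))
      0 m.
Proof.
  assert (Hpow : Npowc c (1 - - NtoC m) = NtoC c ^ (m + 1)).
  { rewrite Npowc_1_minus, npower_neg_nat by lia. unfold Npow_seq.
    rewrite Nat.add_1_r. reflexivity. }
  assert (Hne : 1 - NtoC c ^ (m + 1) <> 0).
  { intros E. apply Cminus_eq_0 in E. unfold NtoC in E. rewrite <- RtoC_pow in E. apply RtoC_inj in E.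
    apply le_INR in hc. simpl in hc.
    pose proof (Rlt_pow_R1 (INR c) (m + 1) ltac:(lra) ltac:(lia)). lra. }
  split.
  - unfold zeta_sub. rewrite Hpow. field. exact Hne.
  - rewrite (zeta_sub_neg_nat zeta c m Hzeta hc). unfold Cdiv at 1. rewrite Cmult_1_l. reflexivity.
Qed.
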